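(* Let $\mathcal{F}$ be an algebraic function field with full constant field $\mathbb{F}_q$ and genus $g$. Assume that $\operatorname{Aut}_{\mathbb{F}_q}(\mathcal{F})$ has a subgroup $G$ isomorphic to $\mathbb{F}_{q^2}^{*}$, that $g=\frac{(q+1)(q-2)}{2}$, and that $\mathcal{F}$ has exactly $q+1$ rational places over $\mathbb{F}_q$. Then $\mathcal{F}$ is $\mathbb{F}_q$-birationally equivalent (i.e. $\mathbb{F}_q$-isomorphic) to the cyclotomic function field $F(\Lambda_M)$ for some monic irreducible quadratic polynomial $M\in\mathbb{F}_q[T]$.
   Context: $\operatorname{Aut}_{\mathbb{F}_q}(\mathcal{F})$ is the group of automorphisms of $\mathcal{F}$ fixing $\mathbb{F}_q$. Cyclotomic function fields: let $x$ be transcendental over $\mathbb{F}_q$, $R=\mathbb{F}_q[x]$, $F=\mathbb{F}_q(x)$, $\overline{F}$ an algebraic closure of $F$. Make $\overline{F}$ an $R$-module via $z^{g(x)}=g(\varphi)(z)$, where $\varphi(z)=z^q+xz$. For nonzero $M\in R$ (a polynomial $M(T)$ evaluated at $T=x$), $\Lambda_M=\{z\in\overline{F}:z^M=0\}$, and $F(\Lambda_M)$ is the subfield of $\overline{F}$ generated over $F$ by $\Lambda_M$. *)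

(* Defs.v *)
From HB Require Import structures.
From mathcomp Require Import all_boot all_order all_algebra.
Set Implicit Arguments. Unset Strict Implicit. Unset Printing Implicit Defensive.
Import Order.TTheory GRing.Theory Num.Theory.
Local Open Scope ring_scope.

Definition ring_iso (A B : fieldType) (s : A -> B) : Prop :=
  (forall a b, s (a + b) = s a + s b) /\ (forall a b, s (a * b) = s a * s b) /\
  s 1 = 1 /\ bijective s.

Section FunctionField.
Variables (K : finFieldType) (F : fieldType) (iota : {rmorphism K -> F}).

Definition Kcomb n (c : {ffun 'I_n -> K}) (b : 'I_n -> F) : F :=
  \sum_(i < n) iota (c i) * b i.

Definition transcendental (x : F) : Prop :=
  forall p : {poly K}, (map_poly iota p).[x] = 0 -> p = 0.

Definition in_Kx (x z : F) : Prop :=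
  exists p r : {poly K}, (map_poly iota r).[x] != 0 /\
    z = (map_poly iota p).[x] / (map_poly iota r).[x].

Definition finite_over_Kx (x : F) : Prop :=
  exists n (b : 'I_n -> F), forall z, exists r : 'I_n -> F,
    (forall i, in_Kx x (r i)) /\ z = \sum_(i < n) r i * b i.

Definition full_constant_field : Prop :=
  forall z : F, (exists p : {poly K}, p != 0 /\ (map_poly iota p).[z] = 0) ->
    exists c, z = iota c.

Definition is_function_field : Prop :=
  (exists x, transcendental x /\ finite_over_Kx x) /\ full_constant_field.

(* ---- places of F/K, as normalized discrete valuations v : F -> int
   trivial on K (convention v 0 = 0; v 0 "= oo" is handled separately) ---- *)
Definition is_place (v : F -> int) : Prop :=
  v 0 = 0 /\
  (forall a b, a != 0 -> b != 0 -> v (a * b) = v a + v b) /\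
  (forall a b, a != 0 -> b != 0 -> a + b != 0 -> Num.min (v a) (v b) <= v (a + b)) /\
  (exists t, t != 0 /\ v t = 1) /\
  (forall c, c != 0 -> v (iota c) = 0).

Definition val_ring (v : F -> int) (a : F) : bool := (a == 0) || (0 <= v a).
Definition val_ideal (v : F -> int) (a : F) : bool := (a == 0) || (0 < v a).

(* degree of a place: dimension of the residue field O_P/P over K *)
Definition place_deg (v : F -> int) (n : nat) : Prop :=
  exists b : 'I_n -> F, (forall i, val_ring v (b i)) /\
    forall a, val_ring v a -> exists! c : {ffun 'I_n -> K}, val_ideal v (a - Kcomb c b).

Definition rational_place (v : F -> int) : Prop := is_place v /\ place_deg v 1.

Definition exactly_rational_places (N : nat) : Prop :=
  exists f : 'I_N -> F -> int,
    (forall i, rational_place (f i)) /\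
    (forall i j, f i =1 f j -> i = j) /\
    (forall v, rational_place v -> exists i, v =1 f i).

Record divisor := Divisor {
  dsize : nat; dplace : 'I_dsize -> F -> int; dmult : 'I_dsize -> int }.
Arguments dplace : clear implicits.
Arguments dmult : clear implicits.
Arguments dsize : clear implicits.

Definition is_divisor (A : divisor) : Prop :=
  (forall i, is_place (dplace A i)) /\ (forall i j, dplace A i =1 dplace A j -> i = j).

Definition divisor_deg (A : divisor) (d : int) : Prop :=
  exists dg : 'I_(dsize A) -> nat, (forall i, place_deg (dplace A i) (dg i)) /\
    d = \sum_(i < dsize A) dmult A i * (dg i)%:Z.

Definition in_L (A : divisor) (z : F) : Prop :=
  z = 0 \/ forall v, is_place v ->
    (forall i, v =1 dplace A i -> - dmult A i <= v z) /\
    ((forall i, ~ (v =1 dplace A i)) -> 0 <= v z).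

Definition ell (A : divisor) (l : nat) : Prop :=
  exists b : 'I_l -> F, (forall i, in_L A (b i)) /\
    forall z, in_L A z -> exists! c : {ffun 'I_l -> K}, z = Kcomb c b.

Definition has_genus (g : int) : Prop :=
  (forall A, is_divisor A -> exists l, ell A l) /\
  (forall A l d, is_divisor A -> ell A l -> divisor_deg A d -> d - l%:Z + 1 <= g) /\
  (exists A l d, is_divisor A /\ ell A l /\ divisor_deg A d /\ d - l%:Z + 1 = g).

Definition is_Kaut (s : F -> F) : Prop :=
  ring_iso s /\ forall c, s (iota c) = iota c.

Definition has_Fq2_units_subgroup : Prop :=
  exists (L : finFieldType) (h : {unit L} -> F -> F),
    #|L| = (#|K| ^ 2)%N /\ (forall u, is_Kaut (h u)) /\
    (forall u w, h (u * w)%g =1 h u \o h w) /\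
    (forall u w, h u =1 h w -> u = w).

End FunctionField.

Section Carlitz.
Variable K : finFieldType.
Local Notation Kx := {fraction {poly K}}.

Definition kx (p : {poly K}) : Kx := @tofrac _ p.

Definition carlitz_phi : {poly Kx} := 'X^#|K| + (kx 'X)%:P * 'X.

Definition carlitz_poly (M : {poly K}) : {poly Kx} :=
  \sum_(i < size M) (kx (M`_i)%:P)%:P * iter i (fun p => carlitz_phi \Po p) 'X.

(* E (with j : K(x) -> E) is F(Lambda_M): Lambda_M (the roots of M(phi)(z))
   all lie in E and E is generated over K(x) by Lambda_M. *)
Definition is_cyclotomic_field (M : {poly K}) (E : fieldType) (j : {rmorphism Kx -> E}) : Prop :=
  exists rs : seq E,
    map_poly j (carlitz_poly M) = \prod_(r <- rs) ('X - r%:P) /\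
    forall S : E -> Prop,
      (forall a, S (j a)) -> (forall r, r \in rs -> S r) ->
      (forall a b, S a -> S b -> S (a + b)) -> (forall a, S a -> S (- a)) ->
      (forall a b, S a -> S b -> S (a * b)) -> (forall a, S a -> S (a^-1)) ->
      forall e, S e.
End Carlitz.

(* Main.v *)
Require Import Defs.
From HB Require Import structures.
From mathcomp Require Import all_boot all_order all_algebra.
From mathcomp Require Import all_fingroup cyclic finfield generic_quotient polyXY.
From mathcomp Require Import boolp zify ring.
Set Implicit Arguments. Unset Strict Implicit. Unset Printing Implicit Defensive.
Import Order.TTheory GRing.Theory Num.Theory.
Local Open Scope ring_scope.

(* A generator of G = F_(q^2)^* has order q^2 - 1, prime to p, so ramification is
   tame: stabilizers of rational places have order dividing q - 1. Hence the q + 1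
   rational places P_k form one orbit, all fixed by the subgroup H = <e> of order
   m = q - 1, which acts on a uniformizer through a character of exact order m.
   Splitting Riemann-Roch spaces supported on the P_k into eigenspaces of H, and
   using only Riemann's inequality with the given genus, one finds that F^H = K(y)
   with the P_k lying over the places of degree one of K(y), and that an
   eigenfunction z of the inverse character satisfies z^m (y^q - y) = h(y) for a
   polynomial h without roots in K, of degree 2 by a count of degrees and a parity
   argument for the action of G. After rescaling y one has h = - M with M monic
   irreducible. If phi(z) = z^q + x z is the Carlitz action, the substitutions
   y = phi(z) / z and x = (y^(q+1) + a_1 y + a_0) / (y^q - y), with
   M = T^2 + a_1 T + a_0, turn z^(q-1) (y^q - y) = - M(y) into M(phi)(z) = 0, whose
   roots are the K-combinations of z and z y. *)

(** Riemann's inequality bounds dimensions only from below, and the quotient by H is never formed.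
    In the eigenspace of index i the dimension exceeds the degree by a constant [kap i + 1] for
    large divisors, and the value of g amounts to [sum kap i >= m (m - 1) / 2]; in the cyclotomic
    field [kap i = i]. The opposite bounds are arithmetic. If [zz i] generates the i-th eigenspace
    over K[y], then [zz i * zz (m - i) * (y^q - y)] is a polynomial in y without roots in K, because
    all places over elements of K are accounted for. So its degree is never 1, and 0 at most for i =
    m/2, while the genus makes these degrees at most 2 on average: almost no slack is left. The
    degree of h is then 2 modulo m and at most 2 m, and parity has to exclude m + 2. The exceptional
    index m/2 exists only for q odd, which is why the two parities of m are treated differently. *)

Local Notation tofrac := (@FracField.tofrac _).

(** * Dimensions of K-subspaces *)

Section Dimension.
Variables (K : finFieldType) (F : fieldType) (iota : {rmorphism K -> F}).

Definition subsp (S : F -> Prop) : Prop :=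
  [/\ S 0, forall a b, S a -> S b -> S (a + b) & forall c a, S a -> S (iota c * a)].

Definition lin_free n (b : 'I_n -> F) : Prop :=
  forall c, Kcomb iota c b = 0 -> c = [ffun=> 0].

Definition dimS (S : F -> Prop) n : Prop :=
  exists b : 'I_n -> F, [/\ forall i, S (b i), lin_free b &
    forall z, S z -> exists c, z = Kcomb iota c b].

Lemma subsp_opp S a : subsp S -> S a -> S (- a).
Proof. by case=> _ _ hs /(hs (-1)); rewrite rmorphN1 mulN1r. Qed.

Lemma subsp_sub S a b : subsp S -> S a -> S b -> S (a - b).
Proof. by move=> hS ha hb; case: (hS) => _ hadd _; apply: hadd => //; apply: subsp_opp. Qed.

Lemma subsp_sum S (I : Type) (r : seq I) (P : pred I) (f : I -> F) :
  subsp S -> (forall i, P i -> S (f i)) -> S (\sum_(i <- r | P i) f i).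
Proof. by case=> h0 hadd _ hf; apply: big_ind. Qed.

Lemma subsp_Kcomb S n (c : {ffun 'I_n -> K}) b :
  subsp S -> (forall i, S (b i)) -> S (Kcomb iota c b).
Proof. by move=> hS hb; apply: subsp_sum => // i _; case: hS => _ _; apply. Qed.

Lemma Kcomb_sub n (c d : {ffun 'I_n -> K}) b :
  Kcomb iota [ffun i => c i - d i] b = Kcomb iota c b - Kcomb iota d b.
Proof.
by rewrite /Kcomb -sumrB; apply: eq_bigr => i _; rewrite ffunE rmorphB mulrBl.
Qed.

Lemma lin_free_inj n (b : 'I_n -> F) c d :
  lin_free b -> Kcomb iota c b = Kcomb iota d b -> c = d.
Proof.
move=> hb e; have /hb/ffunP h : Kcomb iota [ffun i => c i - d i] b = 0.
  by rewrite Kcomb_sub e subrr.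
by apply/ffunP => i; move: (h i); rewrite !ffunE => /eqP; rewrite subr_eq0 => /eqP.
Qed.

(** Since K is finite, counting suffices: the change of coordinates embeds K^n into K^J. *)
Lemma lin_free_le_span_fin n (J : finType) (b : 'I_n -> F) (d : J -> F) :
  lin_free b -> (forall i, exists c : J -> K, b i = \sum_j iota (c j) * d j) ->
  (n <= #|J|)%N.
Proof.
move=> hb /choice [A hA].
pose f (c : {ffun 'I_n -> K}) : {ffun J -> K} := [ffun j => \sum_i c i * A i j].
have fE c : \sum_j iota (f c j) * d j = Kcomb iota c b.
  rewrite /Kcomb; under eq_bigr => j _ do rewrite ffunE rmorph_sum mulr_suml.
  rewrite exchange_big; apply: eq_bigr => i _ /=.
  rewrite hA mulr_sumr; apply: eq_bigr => j _.
  by rewrite rmorphM mulrA.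
have inj : injective f by move=> c c' e; apply: (lin_free_inj hb); rewrite -!fE e.
have := leq_card f inj; rewrite !card_ffun card_ord leq_exp2l //.
exact: finNzRing_gt1.
Qed.

Lemma lin_free_le_span n m (b : 'I_n -> F) (d : 'I_m -> F) :
  lin_free b -> (forall i, exists c, b i = Kcomb iota c d) -> (n <= m)%N.
Proof.
move=> hb hd; rewrite -[m]card_ord; apply: (lin_free_le_span_fin (d := d) hb) => i.
by have [c ->] := hd i; exists c.
Qed.

Definition cons_fam n (z : F) (b : 'I_n -> F) : 'I_n.+1 -> F :=
  fun i => if unlift ord0 i is Some j then b j else z.

Lemma Kcomb_cons n z (b : 'I_n -> F) c :
  Kcomb iota c (cons_fam z b) =
  iota (c ord0) * z + Kcomb iota [ffun i => c (lift ord0 i)] b.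
Proof.
rewrite /Kcomb big_ord_recl /cons_fam unlift_none; congr (_ + _).
by apply: eq_bigr => i _; rewrite liftK ffunE.
Qed.

Lemma lin_free_cons n z (b : 'I_n -> F) :
  lin_free b -> (forall c, z <> Kcomb iota c b) -> lin_free (cons_fam z b).
Proof.
move=> hb hz c; rewrite Kcomb_cons => e.
have c0 : c ord0 = 0.
  apply/eqP/negPn/negP => c0; apply: (hz [ffun i => - (c ord0)^-1 * c (lift ord0 i)]).
  have -> : Kcomb iota [ffun i => - (c ord0)^-1 * c (lift ord0 i)] b =
    - iota (c ord0)^-1 * Kcomb iota [ffun i => c (lift ord0 i)] b.
    rewrite /Kcomb mulr_sumr; apply: eq_bigr => i _.
    by rewrite !ffunE rmorphM rmorphN mulrA.
  have e' := canRL (addKr _) e; rewrite addr0 in e'.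
  rewrite e' mulrNN mulrA -rmorphM mulVf // rmorph1 mul1r //.
rewrite c0 rmorph0 mul0r add0r in e; move/hb: e => /ffunP e.
apply/ffunP => i; rewrite ffunE; case: (unliftP ord0 i) => [j ->|-> //].
by move: (e j); rewrite !ffunE.
Qed.

Lemma dimS_exists S m (d : 'I_m -> F) :
  (forall z, S z -> exists c, z = Kcomb iota c d) -> exists n, dimS S n.
Proof.
move=> hd.
pose P n := `[< exists b : 'I_n -> F, (forall i, S (b i)) /\ lin_free b >].
have P0 : exists n, P n.
  exists 0%N; apply/asboolP; exists (fun _ => 0); split=> [[]//|c _].
  by apply/ffunP => -[].
have Pm n : P n -> (n <= m)%N.
  by move=> /asboolP [b [hb fb]]; apply: (lin_free_le_span fb) => i; apply: hd.
case: (ex_maxnP P0 Pm) => n /asboolP [b [hb fb]] hmax.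
exists n, b; split=> // z hz; apply: contrapT => hn.
suff: P n.+1 by move=> /hmax; rewrite ltnn.
apply/asboolP; exists (cons_fam z b); split.
  by move=> i; rewrite /cons_fam; case: unlift.
by apply: lin_free_cons => // c e; apply: hn; exists c.
Qed.

Lemma dimS_le S T n m (f : F) : f != 0 ->
  (forall z, S z -> T (f * z)) -> dimS S n -> dimS T m -> (n <= m)%N.
Proof.
move=> f0 hST [b [hb fb _]] [d [_ _ sd]].
apply: (@lin_free_le_span n m (fun i => f * b i) d).
  move=> c e; apply: fb; apply/(mulfI f0); rewrite mulr0 -{}e /Kcomb mulr_sumr.
  by apply: eq_bigr => i _; rewrite mulrCA.
by move=> i; apply: sd; apply: hST.
Qed.

(** The hypothesis expresses codimension at most one without a quotient, in the form in which
    leading coefficients at a rational place provide it. *)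
Lemma dimS_codim1 S S' n n' :
  (forall x y, S x -> S y -> S' x \/ exists c, S' (y - iota c * x)) ->
  dimS S n -> dimS S' n' -> (n <= n'.+1)%N.
Proof.
move=> hc [b [hb fb _]] [d [_ _ sd]].
have [hall|/existsNP [i0 hi0]] := EM (forall i, S' (b i)).
  by apply: leq_trans (lin_free_le_span fb _) (leqnSn _) => i; apply: sd.
apply: (@lin_free_le_span n n'.+1 b (cons_fam (b i0) d) fb) => i.
case: (hc (b i0) (b i)) => // -[c /sd [c' e]].
exists [ffun j => if unlift ord0 j is Some k then c' k else c].
rewrite Kcomb_cons ffunE unlift_none.
have -> : [ffun i1 => [ffun j => if unlift ord0 j is Some k then c' k else c] (lift ord0 i1)] = c'.
  by apply/ffunP => k; rewrite !ffunE liftK.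
by rewrite -e addrC subrK.
Qed.

Lemma dimS_strict S S' n n' z :
  subsp S' -> (forall x, S' x -> S x) -> S z -> ~ S' z ->
  dimS S n -> dimS S' n' -> (n' < n)%N.
Proof.
move=> hS' sub Sz nz [b [hb fb sb]] [d [hd fd _]].
apply: (@lin_free_le_span n'.+1 n (cons_fam z d) b).
  by apply: lin_free_cons => // c e; apply: nz; rewrite e; apply: subsp_Kcomb.
by move=> i; rewrite /cons_fam; case: unlift => [j|]; apply: sb => //; apply: sub.
Qed.

Lemma dimS_sum m S (T : 'I_m -> F -> Prop) n (e : 'I_m -> nat) :
  (forall z, S z -> exists f, (forall i, T i (f i)) /\ z = \sum_i f i) ->
  dimS S n -> (forall i, dimS (T i) (e i)) -> (n <= \sum_i e i)%N.
Proof.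
move=> hS [b [hb fb _]] hT.
pose D i := projT1 (cid (hT i)).
have hD i : forall z, T i z -> exists c, z = Kcomb iota c (D i).
  by rewrite /D; case: (cid (hT i)) => d [].
have -> : (\sum_i e i)%N = #|{: {i : 'I_m & 'I_(e i)}}|.
  by rewrite card_tagged sumnE big_map big_enum; apply: eq_bigr => i _; rewrite card_ord.
apply: (lin_free_le_span_fin (d := fun p => D (tag p) (tagged p)) fb) => i.
have [f [hf ->]] := hS _ (hb i).
pose c j := projT1 (cid (hD j _ (hf j))).
have hc j : f j = Kcomb iota (c j) (D j) by rewrite /c; case: (cid _).
exists (fun p => c (tag p) (tagged p)).
have /= <- := @sig_big_dep _ _ _ _ (fun j : 'I_m => 'I_(e j) : finType) xpredT (fun _ => xpredT)
  (fun j (k : 'I_(e j)) => iota (c j k) * D j k).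
by apply: eq_bigr => j _; rewrite hc.
Qed.

Lemma dimS_pos S n : subsp S -> dimS S n -> (0 < n)%N -> exists2 z, S z & z != 0.
Proof.
move=> hS [b [hb fb sb]] n0; exists (b (Ordinal n0)) => //.
apply/eqP => e; have /fb /ffunP /(_ (Ordinal n0)) :
   Kcomb iota [ffun i => (i == Ordinal n0)%:R] b = 0.
  rewrite /Kcomb (bigD1 (Ordinal n0)) //= e mulr0 add0r big1 // => i ne.
  by rewrite ffunE (negPf ne) rmorph0 mul0r.
by rewrite !ffunE eqxx => /eqP; rewrite oner_eq0.
Qed.

Lemma ell_dimS A l : ell iota A l -> dimS (in_L iota A) l.
Proof.
case=> b [hb ub]; exists b; split=> //.
- move=> c e; have [|c' [_ u]] := ub 0; first by left.
  have -> : c = c' by rewrite -(u c) // e.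
  apply: u; rewrite /Kcomb big1 // => i _; by rewrite ffunE rmorph0 mul0r.
by move=> z /ub [c [hc _]]; exists c.
Qed.

End Dimension.

Definition sdim (K : finFieldType) (F : fieldType) (iota : {rmorphism K -> F})
    (S : F -> Prop) : nat :=
  if pselect (exists n, dimS iota S n) is left H then projT1 (cid H) else 0%N.

Lemma sdimP (K : finFieldType) (F : fieldType) (iota : {rmorphism K -> F}) S :
  (exists n, dimS iota S n) -> dimS iota S (sdim iota S).
Proof. by move=> H; rewrite /sdim; case: pselect => // H'; case: (cid H'). Qed.

Lemma natr_card_finField (K : finFieldType) : #|K|%:R = 0 :> K.
Proof.
rewrite -FinRing.zmodXgE -cardsT.
exact: (@expg_cardG K [set: K]%G (1%R : K) (in_setT _)).
Qed.

(* Taking determinants gives (-1)^n = det(f)^r = 1, because q - 1 divides r. *)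
Lemma dim_even_of_negation (K : finFieldType) (F : fieldType)
    (iota : {rmorphism K -> F}) (V : F -> Prop) (f : F -> F) n r :
  odd #|K| -> (#|K|.-1 %| r)%N -> is_Kaut iota f -> (forall x, V x -> V (f x)) ->
  dimS iota V n -> (forall x, V x -> iter r f x = - x) -> ~~ odd n.
Proof.
move=> oq /dvdnP [r' ->] [[fD [fM _]] fC] hV [b [hb fb sb]] hr.
have f0 : f 0 = 0 by rewrite -(rmorph0 iota) fC.
have [A hA] := choice (fun i => sb _ (hV _ (hb i))).
pose M := \matrix_(i, j) A i j.
pose Mk k := iter k (mulmx M) 1%:M.
have hM k i : iter k f (b i) = \sum_j iota (Mk k i j) * b j.
  elim: k i => [|k IH] i.
    rewrite (bigD1 i) //= mxE eqxx rmorph1 mul1r big1 ?addr0 // => j ij.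
    by rewrite mxE eq_sym (negPf ij) rmorph0 mul0r.
  have fsum (J : finType) (c : J -> K) (x : J -> F) :
      iter k f (\sum_j iota (c j) * x j) = \sum_j iota (c j) * iter k f (x j).
    elim: k {IH} => //= k ->; rewrite (big_morph f fD f0).
    by apply: eq_bigr => j _; rewrite fM fC.
  rewrite iterSr hA /Kcomb fsum.
  under eq_bigr => j _ do rewrite IH mulr_sumr.
  rewrite exchange_big; apply: eq_bigr => j _ /=.
  rewrite mxE rmorph_sum mulr_suml; apply: eq_bigr => l _.
  by rewrite !mxE rmorphM mulrA.
have detM k : \det (Mk k) = \det M ^+ k.
  by elim: k => [|k IH]; rewrite ?det1 // /Mk iterS det_mulmx IH exprS.
have MN : Mk (r' * #|K|.-1)%N = - 1%:M.
  apply/matrixP => i j; have := hM (r' * #|K|.-1)%N i; rewrite hr // => e.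
  have E : Kcomb iota [ffun k => Mk (r' * #|K|.-1)%N i k] b = Kcomb iota [ffun k => - (i == k)%:R] b.
    transitivity (- b i).
      by rewrite e; apply: eq_bigr => k _; rewrite ffunE.
    rewrite /Kcomb (bigD1 i) //= ffunE eqxx rmorphN1 mulN1r big1 ?addr0 // => k ik.
    by rewrite ffunE eq_sym (negPf ik) oppr0 rmorph0 mul0r.
  by have /ffunP /(_ j) := lin_free_inj fb E; rewrite !ffunE => ->; rewrite !mxE.
have D1 : (-1) ^+ n = \det M ^+ (r' * #|K|.-1) :> K.
  by rewrite -detM MN -scaleN1r detZ det1 mulr1.
have N1 : (-1 : K) != 0 by rewrite oppr_eq0 oner_eq0.
have {}D1 : (-1) ^+ n = 1 :> K.
  have d0 : \det M ^+ r' != 0.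
    apply: contraNneq (expf_neq0 n N1) => d0.
    by rewrite D1 exprM d0 expr0n; have := finNzRing_gt1 K; case: #|K| => [|[]].
  rewrite D1 exprM; apply: (mulfI d0); rewrite mulr1 -exprS prednK ?expf_card //.
  by apply: ltnW; apply: finNzRing_gt1.
(* For n odd, -1 = 1 and so 2 = 0 in K; as q = 0 in K with q odd, this gives 1 = 0. *)
apply/negP => on; move: D1; rewrite -signr_odd on expr1 => D1.
have two : 2%:R = 0 :> K by rewrite mulr2n -{1}D1 addNr.
have := natr_card_finField K.
rewrite -[#|K|]odd_double_half oq natrD -mul2n natrM two mul0r addr0 => /eqP.
by rewrite oner_eq0.
Qed.

Lemma size_dvdp_irreducible_exp (R : fieldType) (p h : {poly R}) n :
  irreducible_poly p -> h %| p ^+ n -> exists k, (size h = (size p).-1 * k + 1)%N.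
Proof.
move=> ip; have [sp _] := ip; have p0 : p != 0 by rewrite -size_poly_gt0 ltnW.
elim: n h => [|n IH] h hp.
  by exists 0%N; move: hp; rewrite expr0 dvdp1 muln0 => /eqP.
have [ph|nph] := boolP (p %| h).
  have [r hr] := dvdpP _ _ ph; rewrite hr.
  have : r %| p ^+ n by move: hp; rewrite hr exprSr dvdp_mul2r.
  move=> hr'; have [k hk] := IH r hr'; exists k.+1.
  have r0 : r != 0 by rewrite -size_poly_gt0 hk addn1.
  have [a ha] : exists a, size p = a.+1 by exists (size p).-1; rewrite prednK // ltnW.
  by rewrite size_mul // hk ha /= mulnS; lia.
exists 0%N; rewrite muln0; apply/eqP.
have : coprimep p h by rewrite irreducible_poly_coprime.
rewrite coprimep_sym => /(coprimep_expr n.+1) c.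
by move: c; rewrite /coprimep (eqp_size (dvdp_gcd_idl hp)).
Qed.

(** * Places and automorphisms *)

Section Places.
Variables (K : finFieldType) (F : fieldType) (iota : {rmorphism K -> F}).

(* Spares the case distinction caused by the convention v 0 = 0. *)
Definition vge (v : F -> int) (s : int) (z : F) : bool := (z == 0) || (s <= v z).

Section OnePlace.
Variables (v : F -> int) (Pv : is_place iota v).

Lemma place0 : v 0 = 0. Proof. by case: Pv. Qed.

Lemma placeM a b : a != 0 -> b != 0 -> v (a * b) = v a + v b.
Proof. by case: Pv => _ [h _]; apply: h. Qed.

Lemma placeC c : v (iota c) = 0.
Proof.
case: Pv => h0 [_ [_ [_ h]]]; have [->|/h//] := eqVneq c 0.
by rewrite rmorph0 h0.
Qed.

Lemma place1 : v 1 = 0. Proof. by rewrite -(rmorph1 iota) placeC. Qed.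

Lemma placeV a : v a^-1 = - v a.
Proof.
have [->|a0] := eqVneq a 0; first by rewrite invr0 place0 oppr0.
by apply/eqP; rewrite -addr_eq0 -placeM ?invr_eq0 // mulVf // place1.
Qed.

Lemma placeX a k : v (a ^+ k) = v a *+ k.
Proof.
have [->|a0] := eqVneq a 0.
  by rewrite expr0n; case: k => [|k]; rewrite ?place1 ?place0 ?mulr0n ?mul0rn.
by elim: k => [|k IH]; rewrite ?place1 ?mulr0n // exprS placeM ?expf_neq0 // IH mulrS.
Qed.

Lemma placeN a : v (- a) = v a.
Proof.
have [->|a0] := eqVneq a 0; first by rewrite oppr0.
by rewrite -mulN1r -(rmorph1 iota) -rmorphN placeM // ?placeC ?add0r // fmorph_eq0 oppr_eq0 oner_eq0.
Qed.

Lemma vgeE z s : z != 0 -> vge v s z = (s <= v z).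
Proof. by rewrite /vge => /negPf ->. Qed.

Lemma vge0 s : vge v s 0. Proof. by rewrite /vge eqxx. Qed.

Lemma vge_v z : vge v (v z) z. Proof. by rewrite /vge lexx orbT. Qed.

Lemma vgeW s s' z : s' <= s -> vge v s z -> vge v s' z.
Proof. by move=> le /orP[/eqP->|h]; rewrite ?vge0 // /vge (le_trans le h) orbT. Qed.

Lemma vgeD s a b : vge v s a -> vge v s b -> vge v s (a + b).
Proof.
have [->|a0] := eqVneq a 0; first by rewrite add0r.
have [->|b0] := eqVneq b 0; first by rewrite addr0.
have [->|ab0] := eqVneq (a + b) 0; first by rewrite vge0.
rewrite !vgeE // => ha hb.
case: Pv => _ [_ [h _]]; apply: le_trans (h _ _ a0 b0 ab0).
by rewrite le_min ha.
Qed.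

Lemma vgeN s a : vge v s (- a) = vge v s a.
Proof. by rewrite /vge oppr_eq0 placeN. Qed.

Lemma vgeB s a b : vge v s a -> vge v s b -> vge v s (a - b).
Proof. by move=> ha hb; apply: vgeD; rewrite ?vgeN. Qed.

Lemma vgeM s s' a b : vge v s a -> vge v s' b -> vge v (s + s') (a * b).
Proof.
have [->|a0] := eqVneq a 0; first by rewrite mul0r (vge0 (s + s')).
have [->|b0] := eqVneq b 0; first by rewrite mulr0 (vge0 (s + s')).
by rewrite !vgeE ?mulf_neq0 // placeM //; apply: lerD.
Qed.

Lemma vgeC c : vge v 0 (iota c).
Proof. by rewrite /vge placeC lexx orbT. Qed.

Lemma vge1 : vge v 0 1. Proof. by rewrite /vge place1 lexx orbT. Qed.

Lemma vgeZ s c a : vge v s a -> vge v s (iota c * a).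
Proof. by move=> h; rewrite -[s]add0r; apply: vgeM => //; apply: vgeC. Qed.

Lemma vgeX s a k : vge v s a -> vge v (s *+ k) (a ^+ k).
Proof.
move=> h; elim: k => [|k IH]; first by rewrite expr0 mulr0n vge1.
by rewrite exprS mulrS; apply: vgeM.
Qed.

Lemma vge_sum s (I : Type) (r : seq I) (P : pred I) (f : I -> F) :
  (forall i, P i -> vge v s (f i)) -> vge v s (\sum_(i <- r | P i) f i).
Proof. by move=> h; apply: (big_ind (fun z => vge v s z)) => //; [exact: vge0|exact: vgeD]. Qed.

Lemma place_dom a b : a != 0 -> vge v (v a + 1) b -> a + b != 0 /\ v (a + b) = v a.
Proof.
move=> a0 hb.
have ab0 : a + b != 0.
  apply/eqP => e; have eb : b = - a by apply/eqP; rewrite -addr_eq0 addrC e.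
  by move: hb; rewrite eb vgeN vgeE //; lia.
split=> //; apply/eqP; rewrite eq_le; apply/andP; split.
  have : ~~ (v (a + b) > v a); last by lia.
  apply/negP => h; have : vge v (v a + 1) (a + b - b).
    by apply: vgeB => //; rewrite vgeE //; lia.
  by rewrite addrK vgeE //; lia.
rewrite -vgeE //; apply: vgeD; rewrite ?vge_v //; apply: vgeW hb; lia.
Qed.

(* a is integral at v with residue c. *)
Definition cong a c := vge v 1 (a - iota c).

Lemma cong_vge a c : cong a c -> vge v 0 a.
Proof.
move=> h; rewrite -[a](subrK (iota c)); apply: vgeD; last exact: vgeC.
by apply: vgeW h.
Qed.

Lemma cong_neq0 a c : c != 0 -> cong a c -> a != 0 /\ v a = 0.
Proof.
move=> c0 h; have := @place_dom (iota c) (a - iota c).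
have -> : iota c + (a - iota c) = a by ring.
by rewrite fmorph_eq0 placeC add0r; apply.
Qed.

Lemma congM a b c d : cong a c -> cong b d -> cong (a * b) (c * d).
Proof.
move=> ha hb; rewrite /cong rmorphM.
have -> : a * b - iota c * iota d = a * (b - iota d) + iota d * (a - iota c) by ring.
apply: vgeD; last exact: vgeZ.
by rewrite -[1]add0r; apply: vgeM => //; apply: cong_vge ha.
Qed.

Lemma cong1 : cong 1 1. Proof. by rewrite /cong rmorph1 subrr vge0. Qed.

Lemma congX a c k : cong a c -> cong (a ^+ k) (c ^+ k).
Proof.
move=> h; elim: k => [|k IH]; rewrite ?expr0 ?cong1 // !exprS; exact: congM.
Qed.

Lemma congV a c : c != 0 -> cong a c -> cong a^-1 c^-1.
Proof.
move=> c0 h; have [a0 va] := cong_neq0 c0 h.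
have ic0 : iota c != 0 by rewrite fmorph_eq0.
rewrite /cong fmorphV.
have -> : a^-1 - (iota c)^-1 = (- a^-1 * (iota c)^-1) * (a - iota c) by field; rewrite ?a0 ?ic0 ?c0.
rewrite -[1]add0r; apply: vgeM => //.
rewrite vgeE ?mulf_neq0 ?oppr_eq0 ?invr_eq0 //.
by rewrite placeM ?oppr_eq0 ?invr_eq0 // placeN !placeV va placeC.
Qed.

Lemma cong_inj a c d : cong a c -> cong a d -> c = d.
Proof.
move=> hc hd; apply/eqP; rewrite -subr_eq0; apply/negPn/negP => n0.
have : vge v 1 (iota (c - d)).
  have -> : iota (c - d) = (a - iota d) - (a - iota c) by rewrite rmorphB; ring.
  exact: vgeB.
by rewrite vgeE ?fmorph_eq0 // placeC.
Qed.

End OnePlace.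

Lemma rational_residue v a : rational_place iota v -> vge v 0 a -> exists c, cong v a c.
Proof.
case=> Pv [b [hb ub]] ha.
have KE (c : {ffun 'I_1 -> K}) : Kcomb iota c b = iota (c ord0) * b ord0.
  by rewrite /Kcomb big_ord1.
(* The basis element [b] of the residue field need not have residue 1, so the coordinate of [a] gets
   divided by that of 1. *)
have [c1 [h1 _]] := ub 1 (vge1 Pv); rewrite KE in h1.
have [c [hc _]] := ub a ha; rewrite KE in hc.
have lift z : val_ideal v z -> vge v 1 z.
  by rewrite /val_ideal /vge; case: eqP => //= _; lia.
move: (lift _ h1) (lift _ hc) => {}h1 {}hc.
have c10 : c1 ord0 != 0.
  apply/eqP => e; move: h1; rewrite e rmorph0 mul0r subr0.
  by rewrite vgeE ?oner_eq0 // (place1 Pv).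
exists (c ord0 / c1 ord0); rewrite /cong.
have -> : a - iota (c ord0 / c1 ord0) = (a - iota (c ord0) * b ord0) -
   iota (c ord0 / c1 ord0) * (1 - iota (c1 ord0) * b ord0).
  rewrite mulrBr mulr1 mulrA -rmorphM divfK //; ring.
by apply: vgeB => //; apply: vgeZ.
Qed.

Lemma rational_codim v x y : rational_place iota v -> x != 0 -> vge v (v x) y ->
  exists c, vge v (v x + 1) (y - iota c * x).
Proof.
move=> Rv x0 hy; have Pv := Rv.1.
have [|c hc] := @rational_residue v (y / x) Rv.
  by rewrite -(subrr (v x)); apply: vgeM => //; rewrite -(placeV Pv); apply: vge_v.
exists c; have -> : y - iota c * x = x * (y / x - iota c) by field.
exact/vgeM/hc/vge_v.
Qed.

Section Automorphism.
Variables (s : F -> F) (Hs : is_Kaut iota s).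

Lemma KautD a b : s (a + b) = s a + s b. Proof. by case: Hs => [[]]. Qed.
Lemma KautM a b : s (a * b) = s a * s b. Proof. by case: Hs => [[_ []]]. Qed.
Lemma Kaut1 : s 1 = 1. Proof. by case: Hs => [[_ [_ []]]]. Qed.
Lemma Kaut_bij : bijective s. Proof. by case: Hs => [[_ [_ []]]]. Qed.
Lemma KautC c : s (iota c) = iota c. Proof. by case: Hs. Qed.
Lemma Kaut0 : s 0 = 0. Proof. by rewrite -(rmorph0 iota) KautC. Qed.
Lemma KautZ c a : s (iota c * a) = iota c * s a. Proof. by rewrite KautM KautC. Qed.
Lemma KautN a : s (- a) = - s a.
Proof. by rewrite -mulN1r -(rmorph1 iota) -rmorphN KautZ rmorphN rmorph1 mulN1r. Qed.
Lemma KautB a b : s (a - b) = s a - s b. Proof. by rewrite KautD KautN. Qed.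
Lemma Kaut_eq0 a : (s a == 0) = (a == 0).
Proof. by rewrite -[RHS](inj_eq (bij_inj Kaut_bij)) Kaut0. Qed.
Lemma KautV a : s a^-1 = (s a)^-1.
Proof.
have [->|a0] := eqVneq a 0; first by rewrite invr0 Kaut0 invr0.
by apply: (mulfI (x := s a)); rewrite ?Kaut_eq0 // -KautM !divff ?Kaut_eq0 // Kaut1.
Qed.
Lemma KautX a k : s (a ^+ k) = s a ^+ k.
Proof. by elim: k => [|k IH]; rewrite ?expr0 ?Kaut1 // !exprS KautM IH. Qed.
Lemma Kaut_sum (I : Type) (r : seq I) (P : pred I) (f : I -> F) :
  s (\sum_(i <- r | P i) f i) = \sum_(i <- r | P i) s (f i).
Proof. exact: (big_morph s KautD Kaut0). Qed.

Lemma vge_Kaut v k z : vge (v \o s) k z = vge v k (s z).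
Proof. by rewrite /vge Kaut_eq0. Qed.

Lemma vge_fix v k z : v \o s =1 v -> vge v k (s z) = vge v k z.
Proof. by move=> vs; rewrite -vge_Kaut /vge vs. Qed.

Lemma place_Kaut v : is_place iota v -> is_place iota (v \o s).
Proof.
move=> Pv; split; first by rewrite /= Kaut0 (place0 Pv).
split; first by move=> a b a0 b0 /=; rewrite KautM (placeM Pv) ?Kaut_eq0 //.
split.
  move=> a b a0 b0 ab0 /=; case: Pv => _ [_ [h _]].
  by rewrite KautD; apply: h; rewrite -?KautD Kaut_eq0.
split.
  case: Pv => _ [_ [_ [[t [t0 ht]] _]]]; have [s' sK s'K] := Kaut_bij.
  by exists (s' t); rewrite /= s'K; split=> //; rewrite -Kaut_eq0 s'K.
by move=> c _ /=; rewrite KautC (placeC Pv).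
Qed.

Lemma rational_Kaut v : rational_place iota v -> rational_place iota (v \o s).
Proof.
case=> Pv [b [hb ub]]; split; first exact: place_Kaut.
have [s' sK s'K] := Kaut_bij.
exists (s' \o b); split.
  by move=> i; move: (hb i); rewrite /val_ring /= -(Kaut_eq0 (s' _)) !s'K.
have KE c : s (Kcomb iota c (s' \o b)) = Kcomb iota c b.
  by rewrite /Kcomb Kaut_sum; apply: eq_bigr => i _; rewrite KautZ /= s'K.
have IE a c : val_ideal (v \o s) (a - Kcomb iota c (s' \o b)) =
    val_ideal v (s a - Kcomb iota c b).
  by rewrite /val_ideal /= KautB KE -(Kaut_eq0 (_ - _)) KautB KE.
move=> a; rewrite /val_ring /= -(Kaut_eq0 a) => /ub [c [hc uc]].
exists c; split; first by rewrite IE.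
by move=> d; rewrite IE; apply: uc.
Qed.

(* s acts trivially on the residue field K, so the residue of s z / z depends
   only on v z. *)
Lemma tame_character v t w z : rational_place iota v -> v \o s =1 v ->
  t != 0 -> v t = 1 -> w != 0 -> cong v (s t / t) w -> z != 0 ->
  cong v (s z / z) (w ^ (v z)).
Proof.
move=> Rv vs t0 vt w0 ht z0; have Pv := Rv.1.
have unit u : u != 0 -> v u = 0 -> cong v (s u / u) 1.
  move=> u0 vu; have [|c hc] := @rational_residue v u Rv; first by rewrite vgeE // vu.
  have c0 : c != 0.
    apply/eqP => c0; move: hc; rewrite /cong c0 rmorph0 subr0 vgeE // vu //.
  rewrite -(divff c0); apply: congM => //; last exact: congV.
  by rewrite /cong -(KautC c) -KautB vge_fix.
have [n [e|e]] : exists n : nat, v z = n%:Z \/ v z = - n%:Z.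
  by case: (v z) => n; [exists n; left|exists n.+1; right; rewrite NegzE].
- have -> : s z / z = (s t / t) ^+ n * (s (z / t ^+ n) / (z / t ^+ n)).
    rewrite KautM KautV KautX expr_div_n; field.
    by rewrite z0 !expf_neq0 // Kaut_eq0.
  rewrite -[w ^ _]mulr1 e; apply: congM => //; first exact: congX.
  apply: unit; first by rewrite mulf_neq0 ?invr_eq0 ?expf_neq0.
  by rewrite (placeM Pv) ?invr_eq0 ?expf_neq0 // (placeV Pv) (placeX Pv) vt e; lia.
- have -> : s z / z = (s t / t)^-1 ^+ n * (s (z * t ^+ n) / (z * t ^+ n)).
    rewrite KautM KautX invfM invrK exprMn exprVn; field.
    by rewrite ?z0 ?t0 ?expf_neq0 ?Kaut_eq0.
  rewrite -[w ^ _]mulr1 e; apply: congM => //.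
    by rewrite -invr_expz -exprnP -exprVn; apply: congX => //; apply: congV.
  apply: unit; first by rewrite mulf_neq0 ?expf_neq0.
  by rewrite (placeM Pv) ?expf_neq0 // (placeX Pv) vt e; lia.
Qed.

(* If d = s z - z were nonzero then s^j z = z + j d modulo higher order terms,
   so s^r = id would force r = 0 in K. *)
Lemma tame_trivial v t r : rational_place iota v -> v \o s =1 v ->
  t != 0 -> v t = 1 -> cong v (s t / t) 1 ->
  iter r s =1 id -> r%:R != 0 :> K -> s =1 id.
Proof.
move=> Rv vs t0 vt ht sr r0 z; apply/eqP; rewrite -subr_eq0.
apply/negPn/negP => d0; set d := s z - z in d0; have Pv := Rv.1.
have e2 : s z = d + z by rewrite subrK.
clearbody d.
have hd : vge v (v d + 1) (s d - d).
  have -> : s d - d = d * (s d / d - 1) by field.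
  apply: vgeM => //; first exact: vge_v.
  have := tame_character Rv vs t0 vt (oner_neq0 _) ht d0.
  by rewrite exp1rz /cong rmorph1.
have hi j : vge v (v d + 1) (iter j s z - z - d *+ j).
  elim: j => [|j IH]; first by rewrite /= mulr0n !subr0 subrr vge0.
  have -> : iter j.+1 s z - z - d *+ j.+1 =
     s (iter j s z - z - d *+ j) + (s d - d) *+ j.
    have e1 : s (d *+ j) = s d *+ j.
      by rewrite -mulr_natr KautM -[j%:R](rmorph_nat iota) KautC rmorph_nat mulr_natr.
    rewrite iterS !KautB e1 mulrSr mulrnBl e2.
    move: (s d *+ j) (d *+ j) (s (iter _ _ _)) => A B C; ring.
  apply: (vgeD Pv); first by rewrite vge_fix.
  by rewrite -mulr_natl -(rmorph_nat iota); apply: vgeZ.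
move: (hi r); rewrite sr subrr sub0r (vgeN Pv).
rewrite -mulr_natl -(rmorph_nat iota) vgeE ?mulf_neq0 ?fmorph_eq0 //.
by rewrite (placeM Pv) ?fmorph_eq0 // (placeC Pv); lia.
Qed.

End Automorphism.

Lemma Kaut_iter s k : is_Kaut iota s -> is_Kaut iota (iter k s).
Proof.
move=> Hs; elim: k => [|k IH]; first by split=> //; split=> //; split=> //; split=> //; exists id.
split; last by move=> c /=; rewrite (KautC IH) (KautC Hs).
split; first by move=> a b /=; rewrite (KautD IH) (KautD Hs).
split; first by move=> a b /=; rewrite (KautM IH) (KautM Hs).
split; first by rewrite /= (Kaut1 IH) (Kaut1 Hs).
exact: bij_comp (Kaut_bij Hs) (Kaut_bij IH).
Qed.

End Places.

Lemma iter_id_mul (T : Type) (f : T -> T) (k : nat) :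
  iter k f =1 id -> forall j, iter (j * k) f =1 id.
Proof. by move=> h j z; rewrite iterM; elim: j => //= j ->; apply: h. Qed.

(** * The orbit of rational places *)

Section Orbit.
Variables (K : finFieldType) (F : fieldType) (iota : {rmorphism K -> F}).
Local Notation q := #|K|.

Lemma generator_of_Fq2_units : has_Fq2_units_subgroup iota ->
  exists2 s, is_Kaut iota s & forall k, iter k s =1 id <-> (q ^ 2 - 1 %| k)%N.
Proof.
case=> L [h [cL [hK [hM hI]]]].
have /cyclicP [x hx] := field_unit_group_cyclic [set: {unit L}]%G.
have ox : #[x]%g = (q ^ 2 - 1)%N.
  by rewrite orderE -hx card_finField_unit cL subn1.
have h1 : h 1%g =1 id.
  move=> z; apply: (bij_inj (Kaut_bij (hK 1%g))).
  by have := hM 1%g 1%g z; rewrite mulg1 /= => <-.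
have hX k : h (x ^+ k)%g =1 iter k (h x).
  elim: k => [|k IH] z; first by rewrite expg0 h1.
  by rewrite expgS hM /= IH.
exists (h x) => // k; rewrite -ox order_dvdn; split.
  by move=> e; apply/eqP/hI => z; rewrite hX e h1.
by move=> /eqP e z; rewrite -hX e h1.
Qed.

Variables (s : F -> F) (Hs : is_Kaut iota s).
Hypothesis order_s : forall k, iter k s =1 id <-> (q ^ 2 - 1 %| k)%N.

Lemma card_gt1 : (1 < q)%N. Proof. exact: finNzRing_gt1. Qed.

Lemma order_factor : (q ^ 2 - 1 = q.-1 * q.+1)%N.
Proof. have := card_gt1; case: q => // n _; rewrite -mulnn; lia. Qed.

(** Tameness: q vanishes in K, so the order of G is -1 there. *)
Lemma order_neq0 : (q ^ 2 - 1)%:R != 0 :> K.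
Proof.
rewrite natrB ?expn_gt0 ?(ltnW card_gt1) // natrX natr_card_finField expr0n sub0r.
by rewrite oppr_eq0 oner_eq0.
Qed.

Lemma uniformizer_residue (v : F -> int) t : rational_place iota v ->
  t != 0 -> v t = 1 -> v (s t) = 1 ->
  exists2 c, c != 0 & cong iota v (s t / t) c.
Proof.
move=> Rv t0 vt vst; have Pv := Rv.1.
have n0 : s t / t != 0 by rewrite mulf_neq0 ?invr_eq0 ?(Kaut_eq0 Hs).
have v0 : v (s t / t) = 0.
  by rewrite (placeM Pv) ?invr_eq0 ?(Kaut_eq0 Hs) // (placeV Pv) vst vt.
have [|c hc] := rational_residue (a := s t / t) Rv; first by rewrite vgeE // v0.
exists c => //; apply/eqP => c0; move: hc; rewrite /cong c0 rmorph0 subr0 vgeE // v0 //.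
Qed.

End Orbit.

Section Stabilizer.
Variables (K : finFieldType) (F : fieldType) (iota : {rmorphism K -> F}).
Variables (s : F -> F) (Hs : is_Kaut iota s).

Lemma iter_residue (v : F -> int) t c j : rational_place iota v ->
  v \o s =1 v -> t != 0 -> v t = 1 -> c != 0 -> cong iota v (s t / t) c ->
  cong iota v (iter j s t / t) (c ^+ j).
Proof.
move=> Rv vs t0 vt c0 hc; have Pv := Rv.1.
have vj k : v (iter k s t) = 1 by elim: k => //= k <-; apply: vs.
elim: j => [|j IH]; first by rewrite /= divff // expr0; apply: cong1.
have n0 : iter j s t != 0 by rewrite (Kaut_eq0 (Kaut_iter j Hs)).
have -> : iter j.+1 s t / t = (s (iter j s t) / iter j s t) * (iter j s t / t).
  by rewrite /=; field; rewrite ?n0 ?t0.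
rewrite exprS; apply: (congM Pv) => //.
by have := tame_character Hs Rv vs t0 vt c0 hc n0; rewrite vj expr1z.
Qed.

End Stabilizer.

Section RationalOrbit.
Variables (K : finFieldType) (F : fieldType) (iota : {rmorphism K -> F}).
Local Notation q := #|K|.
Variables (s : F -> F) (Hs : is_Kaut iota s).
Hypothesis order_s : forall k, iter k s =1 id <-> (q ^ 2 - 1 %| k)%N.

(* The stabilizer of a rational place acts faithfully on P/P^2, a line over K,
   hence embeds into the group of order q - 1. *)
Lemma stabilizer_dvdn (v : F -> int) k : rational_place iota v ->
  v \o iter k s =1 v -> (q.+1 %| k)%N.
Proof.
move=> Rv vs; have Pv := Rv.1; have [_ [_ [_ [[t [t0 vt]] _]]]] := Pv.
have Hk := Kaut_iter k Hs.
have [|c c0 hc] := uniformizer_residue Hk Rv t0 vt.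
  by have := vs t; rewrite /= vt.
have := iter_residue Hk q.-1 Rv vs t0 vt c0 hc.
have -> : c ^+ q.-1 = 1.
  apply: (mulfI c0); rewrite mulr1 -exprS prednK ?expf_card //.
  by apply: ltnW; apply: finNzRing_gt1.
have e z : iter q.-1 (iter k s) z = iter (q.-1 * k) s z by rewrite iterM.
rewrite e => hc'.
have Hk' := Kaut_iter (q.-1 * k) Hs.
have vs' : v \o iter (q.-1 * k) s =1 v.
  by move=> z /=; rewrite iterM; elim: (q.-1) => //= j IH; rewrite -[RHS]IH; apply: vs.
have : iter (q.-1 * k) s =1 id.
  apply: (tame_trivial Hk' Rv vs' t0 vt hc' (r := (q ^ 2 - 1)%N)); last exact: order_neq0.
  move=> z; rewrite -iterM mulnC; apply: iter_id_mul; exact/order_s.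
move/order_s; rewrite order_factor dvdn_pmul2l //.
by have := card_gt1 K; lia.
Qed.

Hypothesis rat : exactly_rational_places iota (q + 1)%N.

Lemma rational_places_orbit : exists (P : 'I_q.+1 -> F -> int) (w : K),
  [/\ forall i, rational_place iota (P i),
      forall i j, P i =1 P j -> i = j,
      forall v, rational_place iota v -> exists i, v =1 P i,
      (forall i j, exists k, P i \o iter k s =1 P j) /\
      (q.-1).-primitive_root w &
      forall i, P i \o iter q.+1 s =1 P i /\
      forall z, z != 0 -> cong iota (P i) (iter q.+1 s z / z) (w ^ (P i z))].
Proof.
case: rat => f [fR [fI fA]].
have i0 : 'I_(q + 1)%N by exists 0%N; rewrite addn1.
pose v0 := f i0; have Rv0 : rational_place iota v0 by apply: fR.
(* By [stabilizer_dvdn] these q + 1 translates of one place are distinct, so by counting they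
   exhaust the rational places. *)
pose P (i : 'I_q.+1) := v0 \o iter i s.
have PR k : rational_place iota (v0 \o iter k s) by apply: rational_Kaut => //; apply: Kaut_iter.
have shift k l : (k <= l)%N -> v0 \o iter k s =1 v0 \o iter l s -> (q.+1 %| l - k)%N.
  move=> kl e; apply: (stabilizer_dvdn Rv0) => z.
  have [g _ gK] := Kaut_bij (Kaut_iter k Hs).
  have /= := e (g z); rewrite -{1}(subnK kl) iterD gK => <- //.
have PI i j : P i =1 P j -> i = j.
  wlog le : i j / (i <= j)%N.
    move=> W; case: (leqP i j) => [/W//|/ltnW /W h e]; symmetry; apply: h => z.
    by rewrite e.
  move=> e; apply/val_inj/eqP; rewrite eqn_leq le /= -subn_eq0.
  have := shift _ _ le e; case: (j - i)%N (leq_subr i j) => // d hd.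
  by move/dvdn_leq => /(_ isT); have := ltn_ord j; lia.
have PA v : rational_place iota v -> exists i, v =1 P i.
  have [p hp] := choice (fun i : 'I_q.+1 => fA _ (PR i)).
  have pI : injective p.
    by move=> i j e; apply: PI => z; have := hp i z; rewrite e -(hp j z).
  have [|p' _ p'K] := inj_card_bij pI; first by rewrite !card_ord addn1.
  move=> /fA [l hl]; exists (p' l) => z; rewrite hl -{1}(p'K l); symmetry; exact: hp.
(* The next translate is some P_j with j <= q, and q + 1 divides q + 1 - j only for j = 0. *)
have fix0 : v0 \o iter q.+1 s =1 v0.
  have [j hj] := PA _ (PR q.+1).
  have /shift h : v0 \o iter j s =1 v0 \o iter q.+1 s by move=> z; rewrite hj.
  have := h (ltnW (ltn_ord j)); have j1 := ltn_ord j.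
  move/dvdn_leq => h'; have j0 : j = 0%N :> nat by lia.
  by move=> z; rewrite hj /P /= j0.
have iC k l z : iter k s (iter l s z) = iter l s (iter k s z) by rewrite -!iterD addnC.
have fixP i : P i \o iter q.+1 s =1 P i.
  by move=> z; rewrite /P /= -iterS iC; apply: fix0.
have [_ [_ [_ [[t [t0 vt]] _]]]] := Rv0.1.
have He := Kaut_iter q.+1 Hs.
have [|w w0 hw] := uniformizer_residue He Rv0 t0 vt; first by have := fix0 t; rewrite /= vt.
have q1 := card_gt1 K.
exists P, w; split=> //; first by move=> i; apply: PR.
- split.
    move=> i j; exists (q.+1 - i + j)%N => z.
    rewrite /P /= -iterD addnA subnKC; last by apply: ltnW.
    by rewrite iterD; apply: fix0.
  have wX : w ^+ q.-1 = 1.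
    by apply: (mulfI w0); rewrite mulr1 -exprS prednK ?expf_card //; lia.
  (* If w has order k, then e^k acts trivially on the uniformizer to first order, hence is the
     identity by tameness; so q^2 - 1 divides k (q + 1), and m divides k. *)
  have [|k hk hd] := @prim_order_exists K q.-1 w _ wX; first by lia.
  move: (hk); suff -> : k = q.-1 by [].
  apply/eqP; rewrite eqn_dvd; apply/andP; split; first by [].
  have := iter_residue He k Rv0 fix0 t0 vt w0 hw.
  rewrite (prim_expr_order hk) -[iter k _ t]iterM => hc'.
  have vs' : v0 \o iter (k * q.+1) s =1 v0.
    by move=> z /=; rewrite iterM; elim: (k) => //= j IH; rewrite -[RHS]IH; apply: fix0.
  have : iter (k * q.+1) s =1 id.
    apply: (tame_trivial (Kaut_iter _ Hs) Rv0 vs' t0 vt hc' (r := (q ^ 2 - 1)%N)); last exact: order_neq0.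
    move=> z; rewrite -iterM mulnC; apply: iter_id_mul; exact/order_s.
  by move/order_s; rewrite order_factor dvdn_pmul2r.
move=> i; split=> // z z0.
pose g := iter i s; have Hg := Kaut_iter i Hs.
have := tame_character He Rv0 fix0 t0 vt w0 hw (z := g z).
rewrite (Kaut_eq0 Hg) => /(_ z0).
rewrite /cong -[v0 (g z)]/(P i z) => h.
rewrite /P (vge_Kaut Hg) (KautB Hg) (KautM Hg) (KautV Hg) (KautC Hg) iC.
exact: h.
Qed.

End RationalOrbit.

Lemma prim_exprz_dvd (R : fieldType) (w : R) m (n : int) : m.-primitive_root w ->
  w ^ n = 1 -> (m %| n)%Z.
Proof.
move=> hw; case: n => n; first by rewrite -exprnP => /eqP; rewrite -(prim_order_dvd hw).
by rewrite NegzE -invr_expz -exprnP => /eqP; rewrite invr_eq1 -(prim_order_dvd hw) dvdzE abszN.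
Qed.

Lemma mulrn_int (x : int) n : x *+ n = x * n%:Z.
Proof. by rewrite -mulr_natr natz. Qed.

Lemma sum_delta n (k : 'I_n) : \sum_l (l == k)%:Z = 1.
Proof. by rewrite (bigD1 k) //= eqxx big1 // => l /negPf ->. Qed.

(** Here M is m, 2 a + 1 is [dd 1], t is [tdeg 1], and u is the degree of the power polynomial for m
    - 1. The degree M (2 a + 1) + M + 2 of h is 2 modulo 2 M and lies between 0 and 2 M, so it is
    2. *)
Lemma kummer_degree_even (M a t u : int) : 2 <= M ->
  0 <= M * (2 * a + 1) + (M + 2) * 1 -> 0 <= u ->
  M * t = M * (2 * a + 1) + (M + 2) * 1 + u -> t <= 2 -> 2 * a + 1 = -1.
Proof.
move=> M2 h1 h2 h3 t2.
have h4 : 0 <= M * (a + 1) + 1 by lia.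
have h5 : M * t <= M * 2 by rewrite ler_pM2l //; lia.
have h6 : M * (a + 1) + 1 <= M by lia.
have a1 : 0 <= a + 1 by rewrite leNgt; apply/negP => ha; nia.
have a2 : a + 1 < 1 by rewrite ltNge; apply/negP => ha; nia.
by lia.
Qed.

(** Here 2 h + 1 is m, d is [dd 1], and 2 k is the degree of the Kummer polynomial. That degree is 2
    modulo the odd number m and at most 2 m; being even, it is 2. *)
Lemma kummer_degree_odd (k h d u : int) : 1 <= h ->
  0 <= (2 * h + 1) * d + (2 * h + 1 + 2) * 1 -> 0 <= u ->
  (2 * h + 1) * 2 = (2 * h + 1) * d + (2 * h + 1 + 2) * 1 + u ->
  (2 * h + 1) * d + (2 * h + 1 + 2) * 1 = 2 * k -> d = -1.
Proof.
move=> h1 h2 h3 h4 h5.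
have [b hb] : exists b, d + 1 = 2 * b by exists (k - 1 - h * (d + 1)); lia.
have {hb} hd : d = 2 * b - 1 by lia.
rewrite hd in h2 h4 *.
have b1 : 0 <= b by rewrite leNgt; apply/negP => ha; nia.
have b2 : b < 1 by rewrite ltNge; apply/negP => ha; nia.
by lia.
Qed.

(** * Eigenspaces in Riemann-Roch spaces *)

Section Setup.
Variables (K : finFieldType) (F : fieldType) (iota : {rmorphism K -> F}).
Local Notation q := #|K|.
Local Notation m := (q.-1).
Local Notation I := 'I_q.+1.
Variables (e : F -> F) (P : I -> F -> int) (w : K).
Hypotheses (He : is_Kaut iota e) (em : iter m e =1 id).
Hypotheses (PR : forall i, rational_place iota (P i))
  (PI : forall i j, P i =1 P j -> i = j)
  (Pfix : forall i, P i \o e =1 P i)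
  (hw : m.-primitive_root w)
  (Pchar : forall i z, z != 0 -> cong iota (P i) (e z / z) (w ^ (P i z))).

Let m_gt0 : (0 < m)%N. Proof. have := card_gt1 K; lia. Qed.
Let PP i : is_place iota (P i) := (PR i).1.

(* The Riemann-Roch space of the divisor \sum_i n_i P_i, where P lists all the
   rational places. *)
Definition Lreg (n : I -> int) (z : F) : Prop :=
  (forall i, vge (P i) (- n i) z) /\
  forall v, is_place iota v -> (forall i, ~ v =1 P i) -> vge v 0 z.

Lemma Lreg_subsp (n : I -> int) : subsp iota (Lreg n).
Proof.
split.
- by split=> [i|v _ _]; apply: vge0.
- by move=> a b [a1 a2] [b1 b2]; split=> [i|v Pv hv];
  [apply: (vgeD (PP i))|apply: (vgeD Pv); [apply: a2|apply: b2]].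
- by move=> c a [a1 a2]; split=> [i|v Pv hv];
  [apply: (vgeZ (PP i))|apply: (vgeZ Pv); apply: a2].
Qed.

Lemma Lreg_mul (n n' : I -> int) a b : Lreg n a -> Lreg n' b -> Lreg (fun i => n i + n' i) (a * b).
Proof.
move=> [a1 a2] [b1 b2]; split=> [i|v Pv hv].
  by rewrite opprD; apply: (vgeM (PP i)).
by rewrite -[0]addr0; apply: (vgeM Pv); [apply: a2|apply: b2].
Qed.

Lemma Lreg_le (n n' : I -> int) a : (forall i, n i <= n' i) -> Lreg n a -> Lreg n' a.
Proof. by move=> le [h1 h2]; split=> // i; apply: vgeW (h1 i); rewrite lerN2. Qed.

Lemma Lreg_in_L n z : Lreg n z <-> in_L iota (Divisor P n) z.
Proof.
split.
  move=> [h1 h2]; have [->|z0] := eqVneq z 0; [by left|right=> v Pv; split].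
    by move=> i /= ev; rewrite ev -vgeE.
  by move=> hv; rewrite -vgeE //; apply: h2.
move=> h; have [->|z0] := eqVneq z 0; first by case: (Lreg_subsp n).
case: h => [/eqP|h]; first by rewrite (negPf z0).
split=> [i|v Pv hv]; rewrite vgeE //; first by have [h1 _] := h _ (PP i); apply: h1.
by have [_] := h v Pv; apply.
Qed.

Lemma Lreg_e n z : Lreg n z -> Lreg n (e z).
Proof.
move=> [h1 h2]; split=> [i|v Pv hv]; first by rewrite (vge_fix He) //; apply: Pfix.
rewrite -(vge_Kaut He); apply: h2; first exact: place_Kaut.
move=> i hi; apply: (hv i) => z'; have [g _ gK] := Kaut_bij He.
by rewrite -[z']gK -[v _]/((v \o e) _) hi -[RHS]/((P i \o e) _) Pfix.
Qed.

Lemma Lreg_iter n k z : Lreg n z -> Lreg n (iter k e z).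
Proof. by move=> h; elim: k => //= k; apply: Lreg_e. Qed.

(* At every P_k the valuation of a nonzero element of eig i is -i modulo m. *)
Definition eig (i : nat) (z : F) : Prop := iota (w ^+ i) * e z = z.

Lemma eig_subsp i : subsp iota (eig i).
Proof.
split; first by rewrite /eig (Kaut0 He) mulr0.
  by move=> a b ha hb; rewrite /eig (KautD He) mulrDr ha hb.
by move=> c a ha; rewrite /eig (KautZ He) mulrCA ha.
Qed.

Lemma eig_mul i j a b : eig i a -> eig j b -> eig (i + j) (a * b).
Proof. by move=> ha hb; rewrite /eig exprD rmorphM (KautM He) mulrACA ha hb. Qed.

Lemma eig_exp i a k : eig i a -> eig (i * k) (a ^+ k).
Proof.
move=> ha; elim: k => [|k IH]; first by rewrite muln0 /eig !expr0 (Kaut1 He) rmorph1 mulr1.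
by rewrite mulnS exprS; apply: eig_mul.
Qed.

Lemma eig_addm i z : eig (i + m) z <-> eig i z.
Proof. by rewrite /eig exprD (prim_expr_order hw) mulr1. Qed.

Lemma eig_const c : eig 0 (iota c).
Proof. by rewrite /eig (KautC He) expr0 rmorph1 mul1r. Qed.

Lemma eig_val i k z : z != 0 -> eig i z -> (m %| P k z + i%:Z)%Z.
Proof.
move=> z0 h; have h1 := Pchar k z0.
have w0 : w != 0.
  by apply/eqP => w0; have := prim_expr_order hw; rewrite w0 expr0n gtn_eqF // => /eqP; rewrite eq_sym oner_eq0.
have E : e z / z = iota (w ^- i).
  rewrite fmorphV -{2}h invfM mulrCA divff ?mulr1 ?(Kaut_eq0 He) //.
have h2 : cong iota (P k) (e z / z) (w ^- i) by rewrite /cong E subrr; apply: vge0.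
apply: (prim_exprz_dvd hw); rewrite expfzDr // (cong_inj (PP k) h1 h2).
by rewrite -exprnP mulVf // expf_neq0.
Qed.

(** Valuations in [eig i] are -i modulo m, so a bound that misses such a value by less than m
    improves to it for free. *)
Lemma vge_round i k c z : eig i z -> vge (P k) (- (m%:Z * c + i%:Z) - m%:Z + 1) z ->
  vge (P k) (- (m%:Z * c + i%:Z)) z.
Proof.
move=> h; have [->|z0] := eqVneq z 0; first by move=> _; apply: vge0.
have /dvdzP [d hd] := eig_val k z0 h; rewrite !vgeE // => h'.
have : - c - 1 < d; last by nia.
by rewrite ltNge; apply/negP => h2; nia.
Qed.

(* The part in eig i of the Riemann-Roch space of \sum_k (m C_k + i) P_k. Up to
   rounding, every invariant divisor supported on the P_k has this shape. *)
Definition L (i : nat) (C : I -> int) (z : F) : Prop :=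
  eig i z /\ Lreg (fun k => m%:Z * C k + i%:Z) z.

Lemma L_subsp i C : subsp iota (L i C).
Proof.
have [e0 eD eZ] := eig_subsp i; have [l0 lD lZ] := Lreg_subsp (fun k => m%:Z * C k + i%:Z).
split=> //; first by move=> a b [? ?] [? ?]; split; [apply: eD|apply: lD].
by move=> c a [? ?]; split; [apply: eZ|apply: lZ].
Qed.

Lemma L_le i (C C' : I -> int) z : (forall k, C k <= C' k) -> L i C z -> L i C' z.
Proof. by move=> le [h1 h2]; split=> //; apply: Lreg_le h2 => k; have := le k; nia. Qed.

Lemma L_mul i j (C D : I -> int) a b : L i C a -> L j D b -> L (i + j) (fun k => C k + D k) (a * b).
Proof.
move=> [a1 a2] [b1 b2]; split; first exact: eig_mul.
by apply: Lreg_le (Lreg_mul a2 b2) => k; lia.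
Qed.

Lemma L_addm i (C : I -> int) z : L (i + m) C z <-> L i (fun k => C k + 1) z.
Proof.
split=> -[h1 h2]; split; try exact/eig_addm; by apply: Lreg_le h2 => k; lia.
Qed.

(** Raising C_k by one admits m more pole orders at P_k, but by rounding only the largest of them
    occurs in [eig i]; the residue field being K, it costs at most one dimension. *)
Lemma L_codim i (C : I -> int) k x y : L i (fun l => C l + (l == k)%:Z) x ->
   L i (fun l => C l + (l == k)%:Z) y ->
   L i C x \/ exists c, L i C (y - iota c * x).
Proof.
move=> hx hy; have S := L_subsp i (fun l => C l + (l == k)%:Z).
have red z : L i (fun l => C l + (l == k)%:Z) z ->
    vge (P k) (- (m%:Z * (C k + 1) + i%:Z) + 1) z -> L i C z.
  move=> [z1 [z2 z3]] hz; split=> //; split=> // l.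
  have [->|/negPf n] := eqVneq l k; last by have := z2 l; rewrite n addr0.
  by apply: vge_round => //; apply: vgeW hz; lia.
have [->|x0] := eqVneq x 0; first by left; case: (L_subsp i C).
have [vx|vx] := boolP (vge (P k) (- (m%:Z * (C k + 1) + i%:Z) + 1) x).
  by left; apply: red.
right; have hxk := hx.2.1 k; have hyk := hy.2.1 k; rewrite eqxx in hxk hyk.
have vxE : P k x = - (m%:Z * (C k + 1) + i%:Z).
  by move: hxk vx; rewrite !vgeE //; lia.
have [|c hc] := rational_codim (PR k) x0 (y := y); first by rewrite vxE.
exists c; apply: red; last by rewrite -vxE.
by apply: (subsp_sub S) => //; case: (S) => _ _ hZ; exact: hZ.
Qed.

(* The sign is 1/m, because m = q - 1 = -1 in K. *)
Definition proj i z := - \sum_(j < m) iota (w ^+ (i * j)) * iter j e z.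

Lemma eig_proj i z : eig i (proj i z).
Proof.
rewrite /eig /proj (KautN He) mulrN; congr (- _).
rewrite (Kaut_sum He) mulr_sumr.
pose f j := iota (w ^+ (i * j)) * iter j e z.
have -> : \sum_(j < m) iota (w ^+ (i * j)) * iter j e z = \sum_(j < m) f j by [].
under eq_bigr => j _.
  rewrite (KautZ He) mulrA -rmorphM -exprD -mulnS -iterS -/(f j.+1); over.
have fm : f m = f 0%N.
  by rewrite /f em muln0 mulnC exprM (prim_expr_order hw) expr1n expr0.
move: fm; case: (m) m_gt0 => // m' _ fm.
by rewrite big_ord_recr big_ord_recl /= fm addrC.
Qed.

Lemma sum_proj z : \sum_(i < m) proj i z = z.
Proof.
rewrite /proj sumrN exchange_big /=.
rewrite (bigD1 (Ordinal m_gt0)) //= [X in _ + X]big1 => [|j j0].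
  under eq_bigr => i _ do rewrite muln0 expr0 rmorph1 mul1r.
  rewrite sumr_const card_ord addr0 -mulNrn -mulr_natl -(rmorph_nat iota).
  have -> : m%:R = -1 :> K.
    by rewrite -subn1 natrB ?natr_card_finField ?sub0r // ltnW // card_gt1.
  by rewrite rmorphN1 mulN1r opprK.
rewrite -mulr_suml -rmorph_sum.
suff -> : \sum_(i < m) w ^+ (i * j) = 0 by rewrite rmorph0 mul0r.
have n1 : w ^+ j - 1 != 0.
  rewrite subr_eq0 -(prim_order_dvd hw); apply/negP => /dvdn_leq.
  have := ltn_ord j; move: j0; rewrite -val_eqE /=; lia.
apply: (mulfI n1); rewrite mulr0.
under eq_bigr => i _ do rewrite mulnC exprM.
by rewrite -subrX1 -exprM mulnC exprM (prim_expr_order hw) expr1n subrr.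
Qed.

Lemma Lreg_proj (n : I -> int) i z : Lreg n z -> Lreg n (proj i z).
Proof.
move=> h; have S := Lreg_subsp n; apply: (subsp_opp S); apply: (subsp_sum _ S) => j _.
by case: S => _ _ hZ; apply: hZ; apply: Lreg_iter.
Qed.

Lemma L_proj i (C : I -> int) z : (i < m)%N -> Lreg (fun k => m%:Z * C k + m%:Z - 1) z -> L i C (proj i z).
Proof.
move=> im h; have he := eig_proj i z; split=> //.
case: (Lreg_proj i h) => h1 h2; split=> // k; apply: vge_round => //.
by apply: vgeW (h1 k); lia.
Qed.

Definition deg (C : I -> int) : int := \sum_k C k.

Lemma deg_add C D : deg (fun k => C k + D k) = deg C + deg D.
Proof. by rewrite /deg big_split. Qed.

Lemma deg_sub C D : deg (fun k => C k - D k) = deg C - deg D.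
Proof. by rewrite /deg sumrB. Qed.

Lemma deg_scale a C : deg (fun k => a * C k) = a * deg C.
Proof. by rewrite /deg mulr_sumr. Qed.

Lemma deg_const a : deg (fun=> a) = (m%:Z + 2) * a.
Proof.
rewrite /deg sumr_const card_ord -[a *+ _]mulr_natl natz; congr (_ * _).
by have := card_gt1 K; lia.
Qed.

Lemma deg_delta k : deg (fun l => (l == k)%:Z) = 1.
Proof. exact: sum_delta. Qed.

Lemma deg_le C D : (forall k, C k <= D k) -> deg C <= deg D.
Proof. by move=> h; apply: ler_sum => k _; apply: h. Qed.

Lemma deg_lt C D k : (forall k, C k <= D k) -> C k < D k -> deg C < deg D.
Proof.
move=> h hk; rewrite /deg (bigD1 k) //= [X in _ < X](bigD1 k) //=.
by apply: ltr_leD => //; apply: ler_sum => l _; apply: h.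
Qed.

(** * Dimensions of the eigenspaces and Riemann's inequality *)

Section Genus.
Variable (g : int).
Hypothesis Hg : has_genus iota g.
Hypothesis Hgv : 2 * g = (m%:Z + 2) * (m%:Z - 1).
Hypothesis Hc : full_constant_field iota.

Lemma Lreg_dim (n : I -> int) : exists l, dimS iota (Lreg n) l /\ deg n - l%:Z + 1 <= g.
Proof.
case: Hg => h1 [h2 _].
have hD : is_divisor iota (Divisor P n) by split.
have [l hl] := h1 _ hD; exists l; split.
  case: (ell_dimS hl) => b [b1 b2 b3]; exists b; split=> // [i|z /Lreg_in_L /b3 //].
  exact/Lreg_in_L.
apply: (h2 _ _ _ hD hl); exists (fun=> 1%N); split=> [i|]; first exact: (PR i).2.
by apply: eq_bigr => i _; rewrite mulr1.
Qed.

Lemma L_dim i (C : I -> int) : dimS iota (L i C) (sdim iota (L i C)).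
Proof.
apply: sdimP; have [l [[b [_ _ sb]] _]] := Lreg_dim (fun k => m%:Z * C k + i%:Z).
by apply: (dimS_exists (d := b)) => z [_ /sb].
Qed.

Local Notation dL i C := (sdim iota (L i C)).

Lemma dL_le i j (C D : I -> int) f : f != 0 -> (forall z, L i C z -> L j D (f * z)) ->
  (dL i C <= dL j D)%N.
Proof. by move=> f0 h; apply: (dimS_le f0 h) => //; apply: L_dim. Qed.

Lemma dL_sub i (C D : I -> int) : (forall k, C k <= D k) -> (dL i C <= dL i D)%N.
Proof.
move=> h; apply: (dL_le (oner_neq0 F)) => z; rewrite mul1r; exact: L_le.
Qed.

Lemma dL_step i (C : I -> int) k : (dL i (fun l => (C l + (l == k)%:Z)%R) <= (dL i C).+1)%N.
Proof. by apply: (dimS_codim1 _ (L_dim _ _) (L_dim _ _)) => x y; apply: L_codim. Qed.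

Lemma dL_mono i (C D : I -> int) : (forall k, C k <= D k) ->
  (dL i D)%:Z - deg D <= (dL i C)%:Z - deg C.
Proof.
move=> le.
have [d hd] : exists d : nat, deg D = deg C + d%:Z.
  have := deg_le le; exists `|deg D - deg C|%N; lia.
elim: d D le hd => [|d IH] D le hd.
  have E k : D k <= C k.
    by rewrite leNgt; apply/negP => /(deg_lt le); lia.
  by have := dL_sub i E; lia.
have [k hk] : exists k, C k < D k.
  apply: contrapT => /forallNP h; have : deg D <= deg C.
    by apply: deg_le => k; have := h k; lia.
  by lia.
pose D' (l : I) : int := D l - (l == k)%:Z.
have le' l : C l <= D' l by rewrite /D'; case: eqVneq => [->|_]; have := le l; lia.
have sD : deg D' = deg D - 1 by rewrite deg_sub deg_delta.
have := IH D' le'; have := dL_step i D' k.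
have : (dL i D <= dL i (fun l => (D' l + (l == k)%:Z)%R))%N.
  by apply: dL_sub => l; rewrite /D' subrK.
by lia.
Qed.

(** The projections send the Riemann-Roch space of the divisor with multiplicities m C_k + m - 1
    into the spaces [L i C]. Its degree is m deg C + 2 g, so its dimension is at least m deg C + g +
    1, where g + 1 = m (m + 1) / 2. *)
Lemma Riemann_sum (C : I -> int) :
  (m%:Z * deg C + m%:Z)  * 2 + m%:Z * (m%:Z - 1) <= 2 * (\sum_(i < m) dL i C)%N%:Z.
Proof.
have [l [hl hg]] := Lreg_dim (fun k => m%:Z * C k + m%:Z - 1).
have : (l <= \sum_(i < m) dL i C)%N.
  apply: (dimS_sum (T := fun i : 'I_m => L i C) _ hl) => [z hz|i]; last exact: L_dim.
  exists (fun i => proj i z); split; last by rewrite sum_proj.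
  by move=> i; apply: L_proj.
move: hg; rewrite deg_sub deg_add deg_scale !deg_const.
move: Hgv; move: (deg C) (\sum_(i < m) _)%N => d S; move: (m%:Z) => M; nia.
Qed.

(** The space is finite-dimensional and contains all powers of z, so z is algebraic over K. *)
Lemma Lreg0_const z : Lreg (fun=> 0) z -> exists c, z = iota c.
Proof.
move=> hz; apply: Hc; have [l [[b [_ _ sb]] _]] := Lreg_dim (fun=> 0).
have hX i : Lreg (fun=> 0) (z ^+ i).
  elim: i => [|i IH].
    by split=> [k|v Pv _]; rewrite ?oppr0 expr0; [apply: (vge1 (PP k))|apply: (vge1 Pv)].
  by rewrite exprS; apply: Lreg_le (Lreg_mul hz IH) => k; rewrite addr0.
have : ~ lin_free iota (fun i : 'I_l.+1 => z ^+ i).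
  by move=> fz; have := lin_free_le_span fz (fun i => sb _ (hX i)); rewrite ltnn.
move=> /existsNP [c /not_implyP [hc c0]].
exists (\poly_(i < l.+1) c (inord i)); split.
  apply/eqP => p0; apply: c0; apply/ffunP => i; rewrite ffunE.
  have := congr1 (fun p : {poly K} => p`_i) p0.
  by rewrite coef_poly coef0 ltn_ord inord_val.
rewrite (horner_coef_wide (n := l.+1)) ?size_map_poly ?size_poly // -[RHS]hc /Kcomb.
by apply: eq_bigr => i _; rewrite coef_map coef_poly ltn_ord inord_val.
Qed.

Lemma L0_const (C : I -> int) z : (forall k, C k <= 0) -> L 0 C z -> exists c, z = iota c.
Proof. by move=> hC [_ h]; apply: Lreg0_const; apply: Lreg_le h => k; have := hC k; nia. Qed.

Lemma L0_one : L 0 (fun=> 0) 1.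
Proof.
split; first by rewrite -(rmorph1 iota); apply: eig_const.
by split=> [k|v Pv _]; [rewrite mulr0 oppr0; apply: (vge1 (PP k))|apply: (vge1 Pv)].
Qed.

Lemma L0_exp (C : I -> int) y n : L 0 C y -> L 0 (fun k => n%:Z * C k) (y ^+ n).
Proof.
move=> h; elim: n => [|n IH]; first by rewrite expr0; apply: L_le L0_one => k; rewrite mul0r.
by rewrite exprS; apply: L_le (L_mul h IH) => k; lia.
Qed.

(* kap i + 1 is the excess of dim L i C over deg C in large degrees, attained for
   C >= Cs; in particular kap 0 is minus the genus of the fixed field of e. *)
Lemma kappa_exists : exists (kap : nat -> int) (Cs : I -> int),
  [/\ forall i (C : I -> int), (i < m)%N -> deg C + 1 + kap i <= (dL i C)%:Z,
      forall i (C : I -> int), (i < m)%N -> (forall k, Cs k <= C k) ->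
        (dL i C)%:Z = deg C + 1 + kap i,
      m%:Z * (m%:Z - 1) <= 2 * \sum_(i < m) kap i & kap 0%N <= 0].
Proof.
(* Each [dim L i C - deg C] is non-increasing in C by [dL_mono], and Riemann's inequality keeps
   their sum [phi] nonnegative. Above a minimizer [Cs] of [phi] no summand can drop any further. *)
pose phi (C : I -> int) := (\sum_(i < m) dL i C)%N%:Z - m%:Z * deg C.
have phi0 C : 0 <= phi C.
  by rewrite /phi; have := Riemann_sum C; move: m_gt0 (deg C) => m0 d; nia.
have Pex : exists n, `[< exists C : I -> int, phi C = n%:Z >].
  exists `|phi (fun=> 0)|%N; apply/asboolP; exists (fun=> 0).
  by rewrite gez0_abs.
case: (ex_minnP Pex) => n /asboolP [Cs hCs] nmin.
have min C : phi Cs <= phi C.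
  rewrite hCs; have := nmin `|phi C|%N; rewrite -lez_nat gez0_abs //; apply.
  by apply/asboolP; exists C.
pose kap i := (dL i Cs)%:Z - deg Cs - 1.
have eq i (C : I -> int) : (i < m)%N -> (forall k, Cs k <= C k) ->
        (dL i C)%:Z = deg C + 1 + kap i.
  move=> im le; have h j := dL_mono j le.
  have : \sum_(j < m | j != Ordinal im) ((dL j C)%:Z - deg C) <=
         \sum_(j < m | j != Ordinal im) ((dL j Cs)%:Z - deg Cs).
    by apply: ler_sum => j _; apply: h.
  have phiE D : phi D = (dL i D)%:Z - deg D +
     \sum_(j < m | j != Ordinal im) ((dL j D)%:Z - deg D).
    have -> : phi D = \sum_(j < m) ((dL j D)%:Z - deg D).
      rewrite /phi sumrB sumr_const card_ord -mulr_natl natz.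
      by rewrite (big_morph Posz PoszD (erefl _)).
    by rewrite (bigD1 (Ordinal im)).
  by have := h i; have := min C; rewrite !phiE /kap; lia.
exists kap, Cs; split=> //.
- move=> i C im; pose D (k : I) : int := Num.max (C k) (Cs k).
  have hD : forall k, Cs k <= D k by move=> k; rewrite le_max lexx orbT.
  have hD' : forall k, C k <= D k by move=> k; rewrite le_max lexx.
  by have := dL_mono i hD'; have := eq i D im hD; lia.
- have -> : \sum_(i < m) kap i = phi Cs - m%:Z.
    rewrite /kap sumrB sumr_const card_ord natz; congr (_ - _).
    rewrite /phi sumrB sumr_const card_ord -[deg Cs *+ _]mulr_natl natz; congr (_ - _).
    by rewrite (big_morph Posz PoszD (erefl _)).
  have := Riemann_sum Cs; rewrite /phi.
  by move: (deg Cs) (\sum_(i < m) _)%N => d S; move: (m%:Z) => M; nia.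
have C0 : (dL 0 (fun=> 0%R) <= 1)%N.
  have [b [hb fb _]] := L_dim 0 (fun=> 0).
  apply: (lin_free_le_span (d := fun _ : 'I_1 => 1) fb) => i.
  have [c hc] := L0_const (fun k => lexx 0) (hb i).
  by exists [ffun=> c]; rewrite /Kcomb big_ord1 ffunE mulr1.
have : (dL 0 (fun=> 0%R))%:Z >= 1 + kap 0%N.
  pose D (k : I) : int := Num.max 0 (Cs k).
  have hD : forall k, Cs k <= D k by move=> k; rewrite le_max lexx orbT.
  have hD' : forall k, (0 : int) <= D k by move=> k; rewrite le_max lexx.
  have := dL_mono 0 hD'; have := eq 0%N D m_gt0 hD.
  by have := deg_const 0; rewrite mulr0; lia.
by lia.
Qed.

Lemma Lreg_aut f : is_Kaut iota f -> (forall v, rational_place iota v -> exists i, v =1 P i) ->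
  exists t : I -> I, [/\ injective t, forall k, P k \o f =1 P (t k) &
    forall (n : I -> int) z, Lreg n z -> Lreg (n \o t) (f z)].
Proof.
move=> Hf PA; have [t ht] := choice (fun k => PA _ (rational_Kaut Hf (PR k))).
have [f' fK f'K] := Kaut_bij Hf.
have tI : injective t.
  move=> i j eij; apply: PI => z; rewrite -[z]f'K.
  by have := ht i (f' z); rewrite eij -(ht j (f' z)).
exists t; split=> // n z [h1 h2]; split=> [k|v Pv hv].
  by rewrite -(vge_Kaut Hf) /vge ht; apply: h1.
rewrite -(vge_Kaut Hf); apply: h2; first exact: place_Kaut.
move=> l hl; have [t' tK t'K] := injF_bij tI.
apply: (hv (t' l)) => z'; rewrite -[z']f'K -[v _]/((v \o f) _) hl.
by rewrite -[RHS]/((P _ \o f) _) ht t'K.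
Qed.

(** * Rationality of the fixed field *)

Section Kappa.
Variables (kap : nat -> int) (Cs : I -> int).
Hypotheses
  (kap_le : forall i (C : I -> int), (i < m)%N -> deg C + 1 + kap i <= (dL i C)%:Z)
  (kap_eq : forall i (C : I -> int), (i < m)%N -> (forall k, Cs k <= C k) ->
        (dL i C)%:Z = deg C + 1 + kap i)
  (kap_sum : m%:Z * (m%:Z - 1) <= 2 * \sum_(i < m) kap i)
  (kap0 : kap 0%N <= 0).

(** A substitute for the vanishing degree of principal divisors: multiplication by z embeds [L 0 D]
    into [L 0 (C + D)], and for D large both dimensions are known. *)
Lemma L0_deg (C : I -> int) z : z != 0 -> L 0 C z -> 0 <= deg C.
Proof.
move=> z0 hz; pose D (k : I) : int := Num.max (Cs k) (Cs k - C k).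
have h1 k : Cs k <= D k by rewrite le_max lexx.
have h2 k : Cs k <= C k + D k.
  by rewrite /D; lia.
have : (dL 0 D <= dL 0 (fun k => (C k + D k)%R))%N.
  by apply: (dL_le z0) => y hy; apply: L_mul hz hy.
have := kap_eq m_gt0 h1; have := kap_eq m_gt0 h2; rewrite deg_add; lia.
Qed.

Lemma L_neq0 i (C : I -> int) : (i < m)%N -> 0 <= deg C + kap i -> exists2 z, z != 0 & L i C z.
Proof.
move=> im h; have := kap_le C im => h'.
have [|z hz z0] := dimS_pos (L_subsp i C) (L_dim i C); first by lia.
by exists z.
Qed.

Hypothesis PA : forall v, rational_place iota v -> exists i, v =1 P i.
Hypothesis Ptrans : forall i j, exists f,
  [/\ is_Kaut iota f, forall z, f (e z) = e (f z) & P i \o f =1 P j].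

Let delta (j k : I) : int := (k == j)%:Z.

Let sum_delta1 j : deg (delta j) = 1. Proof. exact: deg_delta. Qed.

(* By transitivity a simple pole at one P_j gives one at every P_j, and powers of
   these functions show dim L 0 C > deg C for C >= 0, that is 0 <= kap 0. *)
Lemma no_simple_pole : kap 0%N < 0 -> forall j y, L 0 (delta j) y -> exists c, y = iota c.
Proof.
move=> k0 j y hy; apply: contrapT => nc.
have all k : exists2 z, L 0 (delta k) z & ~ exists c, z = iota c.
  have [f [Hf fe fP]] := Ptrans k j; have [t [tI tP tL]] := Lreg_aut Hf PA.
  exists (f y).
    split; first by move: hy.1; rewrite /eig expr0 rmorph1 !mul1r -fe => ->.
    apply: Lreg_le (tL _ _ hy.2) => l; rewrite /= /delta.
    have tk : t k = j by apply: PI => z; rewrite -tP fP.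
    by rewrite -tk (inj_eq tI).
  case=> c fc; apply: nc; exists c; apply: (bij_inj (Kaut_bij Hf)).
  by rewrite fc (KautC Hf).
(* For large C the dimension is deg C + 1 + [kap 0], which this bound contradicts when
   [kap 0 < 0]. *)
suff lb : forall (d : nat) (C : I -> int), (forall k, 0 <= C k) -> deg C = d%:Z -> (d.+1 <= dL 0 C)%N.
  pose D (k : I) : int := Num.max 0 (Cs k).
  have hD : forall k, Cs k <= D k by move=> k; rewrite le_max lexx orbT.
  have hD' : forall k, (0 : int) <= D k by move=> k; rewrite le_max lexx.
  have := kap_eq m_gt0 hD; have : 0 <= deg D by have := deg_le hD'; rewrite deg_const mulr0.
  case E : (deg D) => [d|//] _.
  by have := lb d D hD' E; lia.
elim=> [|d IH] C C0 hC.
  have [b [_ _ sb]] := L_dim 0 C.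
  have : L 0 C 1 by apply: L_le L0_one.
  case: (dL 0 C) b sb => // b sb /sb [c]; rewrite /Kcomb big_ord0 => /eqP.
  by rewrite oner_eq0.
have [k hk] : exists k, 0 < C k.
  apply: contrapT => /forallNP h; have : deg C <= 0.
    have /deg_le : forall k, C k <= 0 by move=> k; have := h k; lia.
    by rewrite deg_const mulr0.
  by lia.
pose C' (l : I) : int := C l - delta k l.
have C'0 l : 0 <= C' l by rewrite /C' /delta; case: eqVneq => [->|_]; have := C0 l; lia.
apply: leq_ltn_trans (IH C' C'0 _) _; first by rewrite deg_sub sum_delta1; lia.
have [z hz nz] := all k.
have z0 : z != 0 by apply/eqP => z0; apply: nz; exists 0; rewrite rmorph0.
have vz : P k z = - m%:Z.
  have := hz.2.1 k; rewrite /delta eqxx vgeE // => h.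
  apply/eqP; rewrite eq_le; apply/andP; split; last by lia.
  rewrite leNgt; apply/negP => h'; apply: nz.
  apply: (@L0_const (fun=> 0)) => //; split; first exact: hz.1.
  split=> [l|v Pv hv]; last exact: hz.2.2.
  have [->|/negPf nl] := eqVneq l k; last by have := hz.2.1 l; rewrite /delta nl.
  by apply: vge_round; [exact: hz.1|rewrite vgeE //; lia].
have [n hn] : exists n : nat, C k = n%:Z by case: (C k) hk => // n _; exists n.
apply: (dimS_strict (L_subsp 0 C') (z := z ^+ n) _ _ _ (L_dim _ _) (L_dim _ _)).
- by move=> x; apply: L_le => l; rewrite /C' /delta; lia.
- apply: L_le (L0_exp n hz) => l; rewrite /delta.
  by case: eqVneq => [->|_]; rewrite ?hn ?mulr1 // mulr0.
move=> [_ [/(_ k) h _]]; move: h; rewrite vgeE ?expf_neq0 // (placeX (PP k)) vz.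
by rewrite /C' /delta eqxx hn; move: m_gt0; nia.
Qed.

(* This says that the fixed field of e is rational. If kap 0 < 0 then the sum of
   the kap i forces kap i + kap (m - i) > m for some i; products of functions
   in complementary eigenspaces are then constant, so that these functions have
   exactly known divisors, whose differences are the wanted P_j - P_k. *)
Lemma simple_pole_zero j k : j != k -> exists x, [/\ x != 0,
  L 0 (fun l => delta j l - delta k l) x & L 0 (fun l => delta k l - delta j l) x^-1].
Proof.
move=> jk; have [k0|k0] := leP 0 (kap 0%N).
  have ex a b : exists2 z, z != 0 & L 0 (fun l => delta a l - delta b l) z.
    by apply: L_neq0 => //; rewrite deg_sub !sum_delta1; lia.
  have [x x0 hx] := ex j k; have [y y0 hy] := ex k j.
  exists x; split=> //.
  have [c hc] := L0_const (C := fun l => delta j l - delta k l + (delta k l - delta j l))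
    (fun l => ltac:(lia)) (L_mul hx hy).
  have c0 : c != 0 by rewrite -(fmorph_eq0 iota) -hc mulf_neq0.
  have -> : x^-1 = iota c^-1 * y.
    by rewrite fmorphV -hc invfM -mulrA mulVf ?mulr1.
  by case: (L_subsp 0 (fun l => delta k l - delta j l)) => _ _; apply.
(* If all these pairs summed to at most m, twice the sum of [kap i] over i >= 1 would be at most m
   (m - 1), and the negative [kap 0] would violate [kap_sum]. *)
have [i /andP[i0 im] hi] : exists2 i : nat, (0 < i < m)%N & m%:Z + 1 <= kap i + kap (m - i)%N.
  apply: contrapT => /forall2NP h.
  have : \sum_(1 <= i < m) (kap i + kap (m - i)%N) <= \sum_(1 <= i < m) m%:Z.
    rewrite big_nat_cond [X in _ <= X]big_nat_cond; apply: ler_sum => i /andP[hi _].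
    by case: (h i); rewrite ?hi //; lia.
  rewrite big_split /= sumr_const_nat -mulr_natl natz.
  have -> : \sum_(1 <= i < m) kap (m - i)%N = \sum_(1 <= i < m) kap i.
    by rewrite [RHS]big_nat_rev; apply: eq_big_nat => i hi; congr kap; lia.
  move: kap_sum; rewrite -(big_mkord xpredT kap) big_ltn //.
  have -> : (m - 1)%N%:Z = m%:Z - 1 by move: m_gt0; lia.
  by move: (\sum_(1 <= i < m) kap i) k0 => S k0; move: (m%:Z) => M; nia.
have mi : (m - i < m)%N by lia.
have nsp := no_simple_pole k0.
(* The bound on the pair leaves a nonzero partner z' in [L (m - i)] for [delta a - 1 - C]. The
   product z z' has at most a simple pole in the scaling of [L 0], hence is constant; varying [a]
   removes [delta a] from the bound on 1/z. *)
have exact (C : I -> int) : deg C = - kap i ->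
  exists z, [/\ z != 0, L i C z & L (m - i) (fun l => - 1 - C l) z^-1].
  move=> hC; have [|z z0 hz] := @L_neq0 i C im; first by rewrite hC addNr.
  exists z; split=> //.
  have inv a : L (m - i) (fun l => delta a l - 1 - C l) z^-1.
    have [|z' z'0 hz'] := @L_neq0 (m - i) (fun l => delta a l - 1 - C l) mi.
      by rewrite !deg_sub sum_delta1 hC deg_const; lia.
    have [|c hc] := nsp a (z * z').
      have : L m (fun l => C l + (delta a l - 1 - C l)) (z * z').
        by have := L_mul hz hz'; rewrite subnKC // ltnW.
      by rewrite -[m]add0n => /L_addm; apply: L_le => l; lia.
    have c0 : c != 0 by rewrite -(fmorph_eq0 iota) -hc mulf_neq0.
    have -> : z^-1 = iota c^-1 * z'.
      by rewrite fmorphV -hc invfM -mulrA mulVf ?mulr1.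
    by case: (L_subsp (m - i) (fun l => delta a l - 1 - C l)) => _ _; apply.
  split; first exact: (inv j).1.
  split=> [l|v Pv hv]; last exact: (inv j).2.2.
  have [a ha] : exists a, a != l.
    by have [e1|n1] := eqVneq j l; [exists k; rewrite -e1 eq_sym|exists j].
  by have := (inv a).2.1 l; rewrite /delta eq_sym (negPf ha) sub0r.
(* Two divisors of the required degree [- kap i] that differ by P_j - P_k; the quotient of the two
   functions is the wanted x. *)
have [|z1 [z10 h1 h1']] := exact (fun l => - kap i * delta j l).
  by rewrite deg_scale sum_delta1 mulr1.
have [|z2 [z20 h2 h2']] := exact (fun l => - kap i * delta j l + (delta j l - delta k l)).
  by rewrite deg_add deg_scale deg_sub !sum_delta1 subrr addr0 mulr1.
exists (z2 / z1); split; first by rewrite mulf_neq0 ?invr_eq0.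
  have := L_mul h2 h1'; rewrite subnKC 1?ltnW // -[m]add0n => /L_addm.
  by apply: L_le => l; lia.
rewrite invfM invrK mulrC; have := L_mul h1 h2'; rewrite subnKC 1?ltnW // -[m]add0n => /L_addm.
by apply: L_le => l; lia.
Qed.

Definition oo : I := ord0.

Lemma L_exp i (C : I -> int) z n : L i C z -> L (i * n) (fun k => n%:Z * C k) (z ^+ n).
Proof.
move=> [h1 h2]; split; first exact: eig_exp.
have X : Lreg (fun k => n%:Z * (m%:Z * C k + i%:Z)) (z ^+ n).
  elim: n => [|n IH].
    by split=> [k|v Pv _]; rewrite expr0 ?mul0r ?oppr0; [apply: (vge1 (PP k))|apply: (vge1 Pv)].
  by rewrite exprS; apply: Lreg_le (Lreg_mul h2 IH) => k; lia.
by apply: Lreg_le X => k; rewrite PoszM; lia.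
Qed.

Lemma L_expm i (C : I -> int) z : L i C z -> L 0 (fun k => m%:Z * C k + i%:Z) (z ^+ m).
Proof.
move=> /(L_exp m) [h1 h2]; split; last by apply: Lreg_le h2 => k; rewrite PoszM; lia.
by move: h1; rewrite /eig mulnC exprM (prim_expr_order hw) expr1n expr0.
Qed.

(** Invariant functions with divisor exactly -m sum_k C_k P_k: the bound on the inverse makes the
    first one sharp. *)
Definition Lunit (C : I -> int) z := [/\ z != 0, L 0 C z & L 0 (fun k => - C k) z^-1].

Lemma Lunit_val C z k : Lunit C z -> P k z = - (m%:Z * C k).
Proof.
case=> z0 h1 h2; have := h1.2.1 k; have := h2.2.1 k.
rewrite !vgeE ?invr_eq0 // (placeV (PP k)); lia.
Qed.

Lemma Lunit_mul C D a b : Lunit C a -> Lunit D b -> Lunit (fun k => C k + D k) (a * b).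
Proof.
case=> a0 a1 a2 [b0 b1 b2]; split; first by rewrite mulf_neq0.
  exact: L_mul a1 b1.
by rewrite invfM; apply: L_le (L_mul a2 b2) => k; lia.
Qed.

Lemma Lunit_le C D a : (forall k, C k = D k) -> Lunit C a -> Lunit D a.
Proof.
by move=> h [a0 a1 a2]; split=> //; [apply: L_le a1|apply: L_le a2] => k; rewrite h.
Qed.

Lemma Lunit_prod (J : Type) (r : seq J) (Q : pred J) (C : J -> I -> int) (f : J -> F) :
  (forall j, Q j -> Lunit (C j) (f j)) ->
  Lunit (fun k => \sum_(j <- r | Q j) C j k) (\prod_(j <- r | Q j) f j).
Proof.
move=> h; elim: r => [|j r IH].
  apply: (@Lunit_le (fun=> 0)); first by move=> k; rewrite big_nil.
  rewrite big_nil; split; rewrite ?oner_eq0 ?invr1 //; first exact: L0_one.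
  by apply: L_le L0_one => k; rewrite oppr0.
rewrite big_cons; case: ifP => Qj; last by apply: (Lunit_le _ IH) => k; rewrite big_cons Qj.
by apply: (Lunit_le _ (Lunit_mul (h j Qj) IH)) => k; rewrite big_cons Qj.
Qed.

(** With y from [coordinate], the union of these spaces over d is a K[y]-module filtered by the pole
    order at P_oo. By [gen_poly] it is free on any nonzero element of least d. *)
Definition T (i : nat) (d : int) (z : F) : Prop := L i (fun l => d * delta oo l) z.

Lemma deltaE j l : delta j l = (l == j)%:Z. Proof. by []. Qed.

(* y - a has divisor m (P_k - P_oo), i.e. P_k lies over y = a. *)
Definition link (y : F) (a : K) (k : I) : Prop :=
  Lunit (fun l => delta oo l - delta k l) (y - iota a).

(** Take y with divisor m times the difference of one place and P_oo. If a is its residue at P_k,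
    rounding makes y - a vanish to order m there. Distinct places give distinct residues, so the q
    places other than P_oo use up all of K, and y^q - y is the product of the y - a. *)
Lemma coordinate : exists y, [/\ T 0 1 y, P oo y = - m%:Z,
  forall k, k != oo -> exists a, link y a k, forall a, exists2 k, k != oo & link y a k &
  Lunit (fun l => (m%:Z + 2) * delta oo l - 1) (y ^+ q - y)].
Proof.
have k1 : exists k1 : I, oo != k1.
  exists ord_max; apply/eqP => /(congr1 val) h.
  by have := card_gt1 K; rewrite -[q]/(val (ord_max : I)) -h.
have [k1' nk1] := k1.
have [y [y0 hy hy']] := simple_pole_zero nk1.
have U : Lunit (fun l => delta oo l - delta k1' l) y.
  by split=> //; apply: L_le hy' => l; lia.
have vy : P oo y = - m%:Z.
  by rewrite (Lunit_val oo U) !deltaE eqxx (negPf nk1) subr0 mulr1.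
have Ty : L 0 (delta oo) y by apply: L_le hy => l; rewrite !deltaE; lia.
have nc a : y - iota a != 0.
  rewrite subr_eq0; apply/eqP => e1; move: vy; rewrite e1 (placeC (PP oo)).
  by move: m_gt0; lia.
have lk k : k != oo -> exists a, link y a k.
  rewrite eq_sym => nk; have [x [x0 hx hx']] := simple_pole_zero nk.
  have [|a ha] := rational_residue (PR k) (a := y).
    by have := Ty.2.1 k; rewrite deltaE eq_sym (negPf nk) mulr0 oppr0.
  exists a; have hya : L 0 (fun l => delta oo l - delta k l) (y - iota a).
    have [eD eN] : eig 0 (y - iota a) /\ L 0 (delta oo) (y - iota a).
      have h : L 0 (delta oo) (y - iota a).
        apply: (subsp_sub (L_subsp 0 (delta oo))) => //.
        rewrite -[iota a]mulr1; case: (L_subsp 0 (delta oo)) => _ _; apply.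
        by apply: L_le L0_one => l; rewrite deltaE.
      by split=> //; case: h.
    split=> //; split=> [l|v Pv hv]; last exact: eN.2.2.
    have [->|nl] := eqVneq l k; last first.
      by apply: vgeW (eN.2.1 l); rewrite !deltaE (negPf nl); lia.
    apply: vge_round => //; rewrite !deltaE eqxx eq_sym (negPf nk).
    by apply: vgeW ha; lia.
  have [c hc] := L0_const (C := fun l => delta oo l - delta k l + (delta k l - delta oo l))
    (fun l => ltac:(lia)) (L_mul hya hx').
  split=> //.
  have -> : (y - iota a)^-1 = iota c^-1 * x^-1 by rewrite fmorphV -hc invfM invrK mulfK.
  case: (L_subsp 0 (fun l => - (delta oo l - delta k l))) => _ _; apply.
  by apply: L_le hx' => l; lia.
exists y; suff Y : (forall a, exists2 k, k != oo & link y a k) /\ Lunit (fun l => (m%:Z + 2) * delta oo l - 1) (y ^+ q - y).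
  by case: Y => Y1 Y2; split=> //; apply: L_le Ty => l; rewrite mul1r.
have [a ha] : exists a : I -> K, forall k, k != oo -> link y (a k) k.
  have ex k : exists a, k != oo -> link y a k.
    have [->|nk] := eqVneq k oo; first by exists 0.
    by have [b hb] := lk k nk; exists b.
  by have [a ha] := choice ex; exists a.
have aI : {in [set~ oo] &, injective a}.
  move=> k l; rewrite !inE => nk nl e1; apply/eqP/negPn/negP => kl.
  have := Lunit_val k (ha k nk); rewrite e1 (Lunit_val k (ha l nl)).
  rewrite !deltaE eqxx (negPf nk) (negPf kl); move: m_gt0; lia.
have aS : a @: [set~ oo] = [set: K].
  apply/eqP; rewrite eqEcard subsetT cardsT (card_in_imset aI) cardsC1 card_ord.
  exact: leqnn.
split.
  move=> b; have : b \in a @: [set~ oo] by rewrite aS.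
  by case/imsetP => k; rewrite !inE => nk ->; exists k => //; apply: ha.
have -> : y ^+ q - y = \prod_(k in [set~ oo]) (y - iota (a k)).
  have := congr1 (fun p => (map_poly iota p).[y]) (finField_genPoly K).
  rewrite rmorphB /= map_polyXn map_polyX hornerD hornerN hornerXn hornerX => ->.
  rewrite rmorph_prod horner_prod -(big_imset (fun b => y - iota b) aI) aS.
  apply: eq_big => [b|b _]; first by rewrite inE.
  by rewrite rmorphB /= map_polyX map_polyC hornerXsubC.
apply: (Lunit_le _ (Lunit_prod _ (C := fun k l => delta oo l - delta k l) _)); last first.
  by move=> k; rewrite !inE => /ha.
move=> l /=; rewrite sumrB sumr_const cardsC1 card_ord -[_ *+ q]mulr_natl natz.
have -> : \sum_(j in [set~ oo]) delta j l = 1 - delta oo l.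
  have := sum_delta l; rewrite (bigD1 oo) //= => h.
  rewrite -h deltaE eq_sym addrAC subrr add0r; apply: eq_big => [j|j _]; first by rewrite !inE.
  by rewrite deltaE eq_sym.
have := card_gt1 K; rewrite deltaE; case: (l == oo) => h; rewrite ?mulr0 ?mulr1 //.
have E (b : nat) : b.+1%:Z = b%:Z + 2 - 1 by lia.
rewrite -E.
by rewrite subrr subr0; congr Posz; apply: (esym (prednK (ltnW (card_gt1 K)))).
Qed.

Lemma T_le i d d' z : d <= d' -> T i d z -> T i d' z.
Proof. by move=> h; apply: L_le => l; rewrite deltaE; case: (l == oo); lia. Qed.

(* The lower bound for d comes from z ^+ m, an invariant function. *)
Lemma min_T i : (i < m)%N -> exists d z, [/\ z != 0, T i d z,
  forall x, T i (d - 1) x -> x = 0 & d <= - kap i /\ 0 <= m%:Z * d + (m%:Z + 2) * i%:Z].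
Proof.
move=> im.
have low d z : z != 0 -> T i d z -> 0 <= m%:Z * d + (m%:Z + 2) * i%:Z.
  move=> z0 hz; have zm : z ^+ m != 0 by rewrite expf_neq0.
  have := L0_deg zm (L_expm hz).
  by rewrite deg_add !deg_scale sum_delta1 deg_const mulr1.
(* A crude consequence of [low], turning the search for the least integer d into one over natural
   numbers. *)
pose d0 := - (2 * i%:Z + (m%:Z + 2)).
pose Q n := `[< exists2 z, z != 0 & T i (d0 + n%:Z) z >].
have [z z0 hz] : exists2 z, z != 0 & T i (- kap i) z.
  by apply: L_neq0 => //; rewrite deg_scale sum_delta1 mulr1 addNr.
have bd d x : x != 0 -> T i d x -> d0 <= d.
  move=> x0 hx; have := low _ _ x0 hx; rewrite /d0; move: m_gt0 im => M1 im.
  rewrite leNgt => h; apply/negP => h'; move: h; nia.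
have exQ : exists n, Q n.
  exists `|- kap i - d0|%N; apply/asboolP; exists z => //.
  by have h := bd _ _ z0 hz; apply: T_le hz; lia.
case: (ex_minnP exQ) => n /asboolP [x x0 hx] nmin.
exists (d0 + n%:Z), x; split=> //.
  move=> x' hx'; apply/eqP/negPn/negP => x'0.
  have := bd _ _ x'0 hx' => h.
  have : Q (n - 1)%N.
    by apply/asboolP; exists x' => //; apply: T_le hx'; lia.
  by move=> /nmin; lia.
split; last by apply: low hx.
have h := bd _ _ z0 hz; have : Q `|- kap i - d0|%N.
  by apply/asboolP; exists z => //; apply: T_le hz; lia.
by move=> /nmin; lia.
Qed.

(** * The Kummer equation *)

Section Coordinate.
Variable y : F.
Hypotheses (Ty : T 0 1 y) (vy : P oo y = - m%:Z)
  (lk : forall k, k != oo -> exists a, link y a k)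
  (lkK : forall a, exists2 k, k != oo & link y a k)
  (UD : Lunit (fun l => (m%:Z + 2) * delta oo l - 1) (y ^+ q - y)).

Local Notation D := (y ^+ q - y).
Local Notation ev p := ((map_poly iota p).[y]).

Let y0 : y != 0.
Proof. by apply/eqP => y0; move: vy; rewrite y0 (place0 (PP oo)); move: m_gt0; lia. Qed.

Lemma evM p r : ev (p * r) = ev p * ev r.
Proof. by rewrite rmorphM hornerM. Qed.
Lemma evX p n : ev (p ^+ n) = ev p ^+ n.
Proof. by rewrite rmorphXn horner_exp. Qed.
Lemma evD p r : ev (p + r) = ev p + ev r.
Proof. by rewrite rmorphD hornerD. Qed.
Lemma ev0 : ev 0 = 0. Proof. by rewrite rmorph0 horner0. Qed.
Lemma evCX c n : ev (c%:P * 'X^n) = iota c * y ^+ n.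
Proof. by rewrite evM evX map_polyC map_polyX hornerC hornerX. Qed.

Lemma ev_sum (p : {poly K}) N : (size p <= N)%N -> ev p = \sum_(i < N) iota p`_i * y ^+ i.
Proof.
move=> h; rewrite (horner_coef_wide (n := N)) ?size_map_poly //.
by apply: eq_bigr => i _; rewrite coef_map.
Qed.

Lemma ev_T (p : {poly K}) (N : nat) : (size p <= N.+1)%N -> T 0 N%:Z (ev p).
Proof.
move=> h; rewrite (ev_sum h); apply: (subsp_sum _ (L_subsp 0 _)) => i _.
case: (L_subsp 0 (fun l => N%:Z * delta oo l)) => _ _; apply.
apply: L_le (L0_exp i Ty) => l; rewrite deltaE mul1r; have := ltn_ord i.
by case: (l == oo); lia.
Qed.

Lemma ev_oo (p : {poly K}) : p != 0 -> ev p != 0 /\ P oo (ev p) = - (m%:Z * (size p).-1%:Z).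
Proof.
move=> p0; have [n hn] : exists n, size p = n.+1.
  by exists (size p).-1; rewrite prednK // lt0n size_poly_eq0.
rewrite (ev_sum (leqnn _)) hn big_ord_recr /= addrC.
have c0 : p`_n != 0 by have := lead_coef_eq0 p; rewrite lead_coefE hn /= => ->.
have a0 : iota p`_n * y ^+ n != 0 by rewrite mulf_neq0 ?expf_neq0 // fmorph_eq0.
have va : P oo (iota p`_n * y ^+ n) = - (m%:Z * n%:Z).
  by rewrite (placeM (PP oo)) ?expf_neq0 ?fmorph_eq0 // (placeC (PP oo)) (placeX (PP oo)) vy; lia.
rewrite -va; apply: (place_dom (PP oo)) => //; rewrite va.
apply: (vge_sum (PP oo)) => i _; apply: (vgeZ (PP oo)).
rewrite vgeE ?expf_neq0 // (placeX (PP oo)) vy; have := ltn_ord i.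
by move: m_gt0; nia.
Qed.

Lemma ev_inj p r : ev p = ev r -> p = r.
Proof.
move=> h; apply/eqP; rewrite -subr_eq0; apply/negPn/negP => /ev_oo [].
by rewrite rmorphB hornerD hornerN h subrr eqxx.
Qed.

Section Generator.
Variables (i : nat) (d : int) (z : F).
Hypotheses (z0 : z != 0) (hz : T i d z) (zmin : forall x, T i (d - 1) x -> x = 0).

Lemma gen_oo : P oo z = - (m%:Z * d + i%:Z).
Proof.
have := hz.2.1 oo; rewrite deltaE eqxx mulr1 vgeE // => h.
apply/eqP; rewrite eq_le h andbT leNgt; apply/negP => h'.
move: z0; rewrite (zmin (x := z)) ?eqxx //; split; first exact: hz.1.
split=> [l|v Pv hv]; last exact: hz.2.2.
have [->|/negPf nl] := eqVneq l oo; last by have := hz.2.1 l; rewrite deltaE nl !mulr0.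
by apply: vge_round; [exact: hz.1|rewrite deltaE eqxx vgeE //; lia].
Qed.

(** A larger valuation would be at least m - i by rounding. Dividing by y - a, which vanishes to
    order m at P_k, would then lower d against minimality. *)
Lemma gen_fin k : k != oo -> P k z = - i%:Z.
Proof.
move=> nk; have := hz.2.1 k; rewrite deltaE (negPf nk) vgeE // => h.
apply/eqP; rewrite eq_le; apply/andP; split; last by lia.
rewrite leNgt; apply/negP => h'.
have [a [ya0 _ ya]] := lk nk.
have h2 : L i (fun l => d * delta oo l - delta k l) z.
  split; first exact: hz.1.
  split=> [l|v Pv hv]; last exact: hz.2.2.
  have [->|/negPf nl] := eqVneq l k.
    by apply: vge_round; [exact: hz.1|rewrite !deltaE eqxx (negPf nk) vgeE //; lia].
  by have := hz.2.1 l; rewrite !deltaE nl subr0.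
have := L_mul h2 ya; rewrite addn0 => h3.
have : z * (y - iota a)^-1 = 0 by apply: zmin; apply: L_le h3 => l; lia.
by move/eqP; rewrite mulf_eq0 invr_eq0 (negPf z0) (negPf ya0).
Qed.

(** Division by z: subtracting a multiple of z y^N cancels the leading term at P_oo, and rounding
    lowers the pole order by a full m. *)
Lemma gen_poly (N : nat) x : T i (d + N%:Z - 1) x ->
  exists2 p : {poly K}, (size p <= N)%N & x = z * ev p.
Proof.
elim: N x => [|N IH] x hx.
  by exists 0; rewrite ?size_poly0 // ev0 mulr0; apply: zmin; apply: T_le hx; lia.
have u0 : z * y ^+ N != 0 by rewrite mulf_neq0 ?expf_neq0.
have vu : P oo (z * y ^+ N) = - (m%:Z * (d + N%:Z) + i%:Z).
  by rewrite (placeM (PP oo)) ?expf_neq0 // (placeX (PP oo)) vy gen_oo; lia.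
have hu : T i (d + N%:Z) (z * y ^+ N).
  by have := L_mul hz (L0_exp N Ty); rewrite addn0; apply: L_le => l; rewrite mul1r; lia.
have hx' : T i (d + N%:Z) x by apply: T_le hx; lia.
have [|c hc] := rational_codim (PR oo) u0 (y := x).
  by rewrite vu; have := hx'.2.1 oo; rewrite deltaE eqxx mulr1.
have hxc : T i (d + N%:Z) (x - iota c * (z * y ^+ N)).
  apply: (subsp_sub (L_subsp i _)) => //.
  by case: (L_subsp i (fun l => (d + N%:Z) * delta oo l)) => _ _; apply.
have [|p sp hp] := IH (x - iota c * (z * y ^+ N)).
  split; first exact: hxc.1.
  split=> [l|v Pv hv]; last exact: hxc.2.2.
  have [->|/negPf nl] := eqVneq l oo; last by have := hxc.2.1 l; rewrite deltaE nl !mulr0.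
  by apply: vge_round; [exact: hxc.1|rewrite deltaE eqxx; apply: vgeW hc; rewrite vu; lia].
exists (p + c%:P * 'X^N).
  apply: leq_trans (size_polyD _ _) _; rewrite geq_max (leq_trans sp) //=.
  have [->|c0] := eqVneq c 0; first by rewrite mul0r size_poly0.
  by rewrite size_Cmul // size_polyXn.
by rewrite evD evCX mulrDr -hp; ring.
Qed.

End Generator.

Lemma T0_min x : T 0 (0 - 1) x -> x = 0.
Proof.
move=> hx; apply/eqP/negPn/negP => x0; have := L0_deg x0 hx.
by rewrite deg_scale sum_delta1.
Qed.

Lemma T0_poly (N : nat) x : T 0 N%:Z x -> exists2 p : {poly K}, (size p <= N.+1)%N & x = ev p.
Proof.
move=> hx; have T1 : T 0 0 1 by apply: L_le L0_one => l; rewrite mul0r.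
have [|p sp hp] := gen_poly (oner_neq0 _) T1 T0_min (N := N.+1) (x := x).
  by apply: T_le hx; lia.
by exists p => //; rewrite hp mul1r.
Qed.

(** A root a of p in K would give x a zero at the place over y = a, where its valuation is 0. *)
Lemma T0_exact (d : int) x : x != 0 -> T 0 d x -> P oo x = - (m%:Z * d) ->
  (forall k, k != oo -> P k x = 0) ->
  exists p : {poly K}, [/\ x = ev p, (size p)%:Z = d + 1 & forall a, ~~ root p a].
Proof.
move=> x0 hx voo vk.
have d0 : 0 <= d by have := L0_deg x0 hx; rewrite deg_scale sum_delta1 mulr1.
have [N hN] : exists N : nat, d = N%:Z by exists `|d|%N; lia.
rewrite hN in hx voo *; have [p sp hp] := T0_poly hx.
have p0 : p != 0 by apply: contra_neq x0 => p0; rewrite hp p0 ev0.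
exists p; split=> //.
  have [_] := ev_oo p0; rewrite -hp voo => /oppr_inj h.
  have : (size p).-1%:Z = N%:Z by move: h m_gt0; nia.
  by have := size_poly_eq0 p; rewrite (negPf p0); lia.
move=> a; apply/negP => /factor_theorem [r hr].
have [k nk ya] := lkK a; have := vk k nk.
have e1 : x = ev r * (y - iota a).
  by rewrite hp hr evM rmorphB /= map_polyX map_polyC hornerXsubC.
have r0 : ev r != 0 by apply: contra_neq x0 => r0; rewrite e1 r0 mul0r.
have ya0 : y - iota a != 0 by case: ya.
rewrite e1 (placeM (PP k)) // (Lunit_val k ya) !deltaE eqxx (negPf nk).
have [N' hN'] : exists N', (size r <= N'.+1)%N by exists (size r).
have := (ev_T hN').2.1 k; rewrite deltaE (negPf nk) mulr0 vgeE //.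
by move: m_gt0; lia.
Qed.

Lemma generators_exist : exists (dd : nat -> int) (zz : nat -> F), forall i, (i < m)%N ->
  [/\ zz i != 0, T i (dd i) (zz i), forall x, T i (dd i - 1) x -> x = 0 &
      dd i <= - kap i /\ 0 <= m%:Z * dd i + (m%:Z + 2) * i%:Z].
Proof.
have ex i : exists p : int * F, (i < m)%N -> [/\ p.2 != 0, T i p.1 p.2,
    forall x, T i (p.1 - 1) x -> x = 0 & p.1 <= - kap i /\ 0 <= m%:Z * p.1 + (m%:Z + 2) * i%:Z].
  have [im|_] := boolP (i < m)%N; last by exists (0, 0).
  by have [d [z h]] := min_T im; exists (d, z).
by have [f hf] := choice ex; exists (fun i => (f i).1), (fun i => (f i).2).
Qed.

(** * Degrees of the polynomials attached to the generators *)

Section Gens.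
Variables (dd : nat -> int) (zz : nat -> F).
Hypothesis Hgen : forall i, (i < m)%N ->
  [/\ zz i != 0, T i (dd i) (zz i), forall x, T i (dd i - 1) x -> x = 0 &
      dd i <= - kap i /\ 0 <= m%:Z * dd i + (m%:Z + 2) * i%:Z].

Let D0 : D != 0. Proof. by case: UD. Qed.

Let D_oo : P oo D = - (m%:Z * (m%:Z + 1)).
Proof. by rewrite (Lunit_val oo UD) deltaE eqxx mulr1; lia. Qed.

Let D_fin k : k != oo -> P k D = m%:Z.
Proof. by move=> nk; rewrite (Lunit_val k UD) deltaE (negPf nk); lia. Qed.

Let UD0 : L 0 (fun l => (m%:Z + 2) * delta oo l - 1) D. Proof. by case: UD. Qed.

(** At each P_k other than P_oo the two generators contribute -i - (m - i) = -m, which the zero of D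
    of order m cancels. *)
Lemma generator_product_poly i : (0 < i < m)%N -> exists p : {poly K}, [/\ zz i * zz (m - i) * D = ev p,
  (size p)%:Z = dd i + dd (m - i) + m%:Z + 2 + 1 & forall a, ~~ root p a].
Proof.
move=> /andP[i0 im]; have mi : (m - i < m)%N by lia.
have [z0 hz zm _] := Hgen im; have [z0' hz' zm' _] := Hgen mi.
apply: T0_exact; first by rewrite !mulf_neq0.
- have := L_mul hz hz'; rewrite subnKC 1?ltnW // -[m]add0n => /L_addm h.
  by apply: L_le (L_mul h UD0) => l; lia.
- rewrite !(placeM (PP oo)) ?mulf_neq0 // D_oo (gen_oo z0 hz zm) (gen_oo z0' hz' zm').
  by rewrite -subzn 1?ltnW //; lia.
move=> k nk; rewrite !(placeM (PP k)) ?mulf_neq0 // D_fin //.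
rewrite (gen_fin z0 hz zm nk) (gen_fin z0' hz' zm' nk) -subzn 1?ltnW //; lia.
Qed.

Lemma generator_power_poly i : (i < m)%N -> exists p : {poly K}, [/\ zz i ^+ m * D ^+ i = ev p,
  (size p)%:Z = m%:Z * dd i + (m%:Z + 2) * i%:Z + 1 & forall a, ~~ root p a].
Proof.
move=> im; have [z0 hz zm _] := Hgen im.
apply: T0_exact; first by rewrite !mulf_neq0 ?expf_neq0.
- apply: L_le (L_mul (L_expm hz) (L0_exp i UD0)) => l.
  by rewrite deltaE; case: (l == oo); lia.
- rewrite !(placeM (PP oo)) ?expf_neq0 // !(placeX (PP oo)) D_oo (gen_oo z0 hz zm).
  by rewrite !mulrn_int; move: (m%:Z) => M; ring.
move=> k nk; rewrite !(placeM (PP k)) ?expf_neq0 // !(placeX (PP k)) D_fin //.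
by rewrite (gen_fin z0 hz zm nk) !mulrn_int; move: (m%:Z) => M; ring.
Qed.

(* The degree in y of the polynomial zz i * zz (m - i) * D. *)
Let tdeg i : int := dd i + dd (m - i)%N + m%:Z + 2.

(** The genus enters here: [dd i <= - kap i] and [kap_sum] bound the sum of the [dd i] by -m (m - 1)
    / 2. *)
Lemma tdeg_sum : \sum_(1 <= i < m) tdeg i <= 2 * (m%:Z - 1).
Proof.
have -> : \sum_(1 <= i < m) tdeg i = 2 * (\sum_(1 <= i < m) dd i) + (m%:Z - 1) * (m%:Z + 2).
  rewrite /tdeg !big_split /=.
  have -> : \sum_(1 <= i < m) dd (m - i)%N = \sum_(1 <= i < m) dd i.
    by rewrite [RHS]big_nat_rev; apply: eq_big_nat => i hi; congr dd; lia.
  rewrite !sumr_const_nat !mulrn_int.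
  have -> : (m - 1)%N%:Z = m%:Z - 1 by move: m_gt0; lia.
  by ring.
have : \sum_(1 <= i < m) dd i <= \sum_(1 <= i < m) - kap i.
  rewrite big_nat_cond [X in _ <= X]big_nat_cond; apply: ler_sum => i /andP[/andP[_ im] _].
  by have [_ _ _ []] := Hgen im.
rewrite sumrN; move: kap_sum; rewrite -(big_mkord xpredT kap) big_ltn //.
move: (\sum_(1 <= i < m) kap i) (\sum_(1 <= i < m) dd i) kap0 => A B k0.
by move: (m%:Z) => M; nia.
Qed.

Lemma tdeg_neq1 i : (0 < i < m)%N -> 0 <= tdeg i /\ tdeg i != 1.
Proof.
move=> him; have [p [_ sp rp]] := generator_product_poly him; rewrite -/(tdeg i) in sp.
have p0 : (0 < size p)%N.
  by rewrite lt0n size_poly_eq0; apply/eqP => p0; have := rp 0; rewrite p0 root0.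
split; first by lia.
apply/eqP => t1; rewrite t1 in sp; have {}sp : size p = 2%N by lia.
have c1 : p`_1 != 0 by have := lead_coef_eq0 p; rewrite lead_coefE sp /= => ->; rewrite -size_poly_eq0 sp.
have := rp (- p`_0 / p`_1); rewrite rootE horner_coef sp !big_ord_recl big_ord0 /=.
by rewrite expr0 mulr1 addr0 expr1 mulrCA divff // mulr1 subrr eqxx.
Qed.

(** The integers m [dd i] + (m + 2) i for i and m - i are nonnegative with sum m [tdeg i]. If
    [tdeg i = 0] both vanish, so m divides 2 i, which forces 2 i = m. *)
Lemma tdeg_ge2 i : (0 < i < m)%N -> 2 <= tdeg i + 2 * (2 * i == m)%:Z.
Proof.
move=> him; have [t0 t1] := tdeg_neq1 him; have [t2|t2] := leP 2 (tdeg i).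
  by case: (_ == _); lia.
have {t1 t2} t0' : tdeg i = 0 by move: t0 t1 t2; lia.
have im : (i < m)%N by lia.
have mi : (m - i < m)%N by lia.
have [_ _ _ [_ h1]] := Hgen im; have [_ _ _ [_ h2]] := Hgen mi.
suff -> : (2 * i == m)%N by lia.
have E : m%:Z * (dd i + i%:Z) = - (2 * i%:Z).
  move: h1 h2 t0'; rewrite /tdeg -subzn 1?ltnW //; move: (m%:Z) (dd i) (dd (m - i)%N) => M a b; nia.
have : dd i + i%:Z = -1 by move: E him m_gt0; nia.
by move=> e1; move: E; rewrite e1; lia.
Qed.

(** The corrected excesses [u i] are nonnegative with sum at most 2 for m even and 0 for m odd. As
    [u] is symmetric under i -> m - i, the index 1 gets at most half of it when m > 2. *)
Lemma tdeg1_bound : (1 < m)%N -> tdeg 1 <= 2 + (~~ odd m)%:Z.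
Proof.
move=> m1; pose u i := tdeg i + 2 * (2 * i == m)%N%:Z - 2.
have u0 i : (0 < i < m)%N -> 0 <= u i by move=> /tdeg_ge2; rewrite /u; lia.
have su : \sum_(1 <= i < m) u i <= 2 * (~~ odd m)%:Z.
  have -> : \sum_(1 <= i < m) u i = \sum_(1 <= i < m) tdeg i +
      2 * \sum_(1 <= i < m) (2 * i == m)%N%:Z - (m%:Z - 1) * 2.
    rewrite /u big_split /= big_split /= -mulr_sumr; congr (_ + _ + _).
    rewrite sumr_const_nat -[LHS]mulr_natl [(m - 1)%:R]natz.
    by have -> : (m - 1)%N%:Z = m%:Z - 1 by [lia]; move: (m%:Z) => M; ring.
  have : \sum_(1 <= i < m) (2 * i == m)%N%:Z <= (~~ odd m)%:Z.
    have [modd|meven] := boolP (odd m).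
      rewrite big_nat big1 // => i _; case: eqP => // e1; move: modd.
      by rewrite -e1 mul2n odd_double.
    have -> : \sum_(1 <= i < m) (2 * i == m)%N%:Z = \sum_(1 <= i < m | i == m./2) 1.
      rewrite [RHS]big_mkcond; apply: eq_bigr => i _.
      rewrite -[X in (_ == X)%N]odd_double_half (negPf meven) add0n -mul2n eqn_pmul2l //.
      by case: (_ == _).
    by rewrite big_nat1_eq; case: ifP.
  by have := tdeg_sum; move: (\sum_(1 <= i < m) tdeg i) (\sum_(1 <= i < m) _) => A B; lia.
have [e2|n2] := eqVneq m 2%N.
  by move: su; rewrite e2 big_nat1 /u e2 /=; lia.
have [m' hm'] : exists m', m = m'.+3 by exists (m - 3)%N; lia.
have : u 1%N + u m'.+2 <= \sum_(1 <= i < m) u i.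
  rewrite hm' big_ltn // big_nat_recr //= lerD2l lerDr big_nat; apply: sumr_ge0 => i hi.
  by apply: u0; lia.
have -> : u m'.+2 = u 1%N.
  rewrite /u /tdeg hm'; have -> : (m'.+3 - m'.+2 = 1)%N by lia.
  have -> : (m'.+3 - 1 = m'.+2)%N by lia.
  have -> : (2 * m'.+2 == m'.+3)%N = false by lia.
  have -> : (2 * 1 == m'.+3)%N = false by lia.
  by ring.
have -> : u 1%N = tdeg 1%N - 2 by rewrite /u; have -> : (2 * 1 == m)%N = false by [lia]; lia.
by case: (odd m) su => /= su; lia.
Qed.

Section Kummer.
Variable s : F -> F.
Hypotheses (Hs : is_Kaut iota s) (es : forall z, e z = iter q.+1 s z).

(* s acts on L i (c, ..., c), a space of dimension c (m + 2) - dd i + 1, and its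
   power e^(m/2) acts as -1 since i is odd; hence that dimension is even. *)
Lemma generator_degree_odd i : ~~ odd m -> (i < m)%N -> odd i -> exists b, dd i = 2 * b + 1.
Proof.
move=> om im oi; have [z0 hz zm [_ hd]] := Hgen im.
(* N is the dimension of [L i (c, ..., c)]: multiplication by D^c identifies that space with [zz i]
   times the polynomials in y of degree below N, and c >= [dd i] makes N meaningful. *)
pose c := `|dd i|%N; pose N := `|(c%:Z * (m%:Z + 2) - dd i + 1)%R|%N.
have hN : N%:Z = c%:Z * (m%:Z + 2) - dd i + 1.
  by rewrite /N gez0_abs //; have : dd i <= c%:Z by [lia]; nia.
have UDi : L 0 (fun l => - ((m%:Z + 2) * delta oo l - 1)) D^-1 by case: UD.
pose b (k : 'I_N) := zz i * y ^+ k * D^-1 ^+ c.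
have E (f : {ffun 'I_N -> K}) :
    Kcomb iota f b = zz i * ev (\sum_k (f k)%:P * 'X^k) * D^-1 ^+ c.
  rewrite rmorph_sum horner_sum mulr_sumr mulr_suml; apply: eq_bigr => k _.
  by rewrite evCX /b; ring.
have bV k : L i (fun=> c%:Z) (b k).
  have := L_mul (L_mul hz (L0_exp k Ty)) (L0_exp c UDi); rewrite !addn0.
  apply: L_le => l; rewrite mul1r deltaE.
  by case: (l == oo); have := ltn_ord k; rewrite -ltz_nat hN; lia.
have dimV : dimS iota (L i (fun=> c%:Z)) N.
  exists b; split=> // [f|x hx].
    rewrite E => /eqP; rewrite !mulf_eq0 (negPf z0) expf_eq0 invr_eq0 (negPf D0) andbF orbF /=.
    move=> /eqP; rewrite -ev0 => /ev_inj h; apply/ffunP => k; rewrite ffunE.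
    have := congr1 (fun p : {poly K} => p`_k) h; rewrite coef0 coef_sum (bigD1 k) //=.
    rewrite coefCM coefXn eqxx mulr1 big1 ?addr0 // => l lk'.
    by rewrite coefCM coefXn eq_sym val_eqE (negPf lk') mulr0.
  have h : T i (dd i + N%:Z - 1) (x * D ^+ c).
    have := L_mul hx (L0_exp c UD0); rewrite addn0; apply: L_le => l; rewrite hN.
    by rewrite deltaE; case: (l == oo); lia.
  have [p sp hp] := gen_poly z0 hz zm h.
  exists [ffun k : 'I_N => p`_k]; rewrite E.
  have -> : \sum_k ([ffun k : 'I_N => p`_k] k)%:P * 'X^k = p.
    apply/polyP => j; rewrite coef_sum.
    have [jN|jN] := ltnP j N.
      rewrite (bigD1 (Ordinal jN)) //= ffunE coefCM coefXn eqxx mulr1 big1 ?addr0 // => k nk.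
      rewrite coefCM coefXn; case: eqP => [e1|]; last by rewrite mulr0.
      by case/eqP: nk; apply: val_inj.
    rewrite nth_default ?(leq_trans sp) // big1 // => k _.
    by rewrite coefCM coefXn gtn_eqF ?mulr0 // (leq_trans (ltn_ord k)).
  by rewrite -hp -mulrA -exprMn divff ?expr1n ?mulr1.
have sC z : s (e z) = e (s z) by rewrite !es -iterS -iterSr.
have sV x : L i (fun=> c%:Z) x -> L i (fun=> c%:Z) (s x).
  move=> [x1 x2]; split; first by rewrite /eig -sC -(KautZ Hs) x1.
  by have [t [_ _ ht]] := Lreg_aut Hs PA; apply: Lreg_le (ht _ _ x2) => l.
have mE : m = (m./2 * 2)%N by rewrite muln2 -[LHS]odd_double_half (negPf om) add0n.
have qm : q = m.+1 by rewrite prednK // ltnW // card_gt1.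
have oq : odd q by rewrite qm /= om.
have wh : w ^+ m./2 = -1.
  have : (w ^+ m./2) ^+ 2 == 1 by rewrite -exprM -mE (prim_expr_order hw).
  rewrite sqrf_eq1 => /orP[|/eqP//]; rewrite -(prim_order_dvd hw) => /dvdn_leq.
  by move: m_gt0; rewrite {2}mE; lia.
have hr x : L i (fun=> c%:Z) x -> iter (m./2 * q.+1) s x = - x.
  move=> [x1 _]; have eN k : iota (w ^+ (i * k)) * iter k e x = x.
    elim: k => [|k IH]; first by rewrite muln0 expr0 rmorph1 mul1r.
    rewrite iterS mulnS exprD rmorphM -mulrA -(KautZ He) IH; exact: x1.
  have -> : iter (m./2 * q.+1) s x = iter m./2 e x.
    by rewrite iterM; elim: (m./2) => //= k ->; rewrite es.
  have := eN m./2; rewrite mulnC exprM wh -signr_odd oi expr1 rmorphN1 mulN1r => h.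
  by rewrite -[in RHS]h opprK.
(* As q is odd, (m/2)(q + 1) is m times the integer (q + 1)/2. *)
have := dim_even_of_negation oq _ Hs sV dimV hr => /(_ _) h.
have {h} oN : ~~ odd N.
  apply: h; apply/dvdnP; exists (q.+1)./2.
  have hE : ((q.+1)./2 * 2 = q.+1)%N by rewrite muln2 -[RHS]odd_double_half /= oq.
  by rewrite -[in LHS]hE [in RHS]mE mulnCA.
have [N' hN'] : exists N', N = (2 * N')%N.
  by exists N./2; rewrite mul2n -[LHS]odd_double_half (negPf oN).
rewrite hN' mE in hN; exists (c%:Z * (m./2%:Z + 1) - N'%:Z); lia.
Qed.

(* zz 1 ^+ m * D and zz (m - 1) ^+ m * D ^+ (m - 1) are polynomials in y with
   product the m-th power of a polynomial of degree tdeg 1 <= 3; parity leaves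
   only degree 2 for the first one. For m odd the parity comes from an
   irreducible quadratic, for m even from generator_degree_odd. *)
Lemma kummer_quadratic : (1 < m)%N -> exists h : {poly K},
  [/\ zz 1 ^+ m * D = ev h, size h = 3%N & forall a, ~~ root h a].
Proof.
move=> m1; have m2 : (m - 1 < m)%N by lia.
have [h [hE sh rh]] := generator_power_poly m1; exists h; split=> //.
have [_ _ _ [_ b1]] := Hgen m1; have [_ _ _ [_ b2]] := Hgen m2.
have t3 := tdeg1_bound m1.
have tE : m%:Z * tdeg 1 = (m%:Z * dd 1 + (m%:Z + 2) * 1) +
    (m%:Z * dd (m - 1) + (m%:Z + 2) * (m - 1)%N%:Z).
  by rewrite /tdeg -subzn 1?ltnW //; move: (m%:Z) => M; ring.
suff d1 : dd 1%N = -1 by move: sh; rewrite d1; lia.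
have [modd|meven] := boolP (odd m); last first.
  have [a ha] := generator_degree_odd meven m1 isT.
  have [|b hb] := generator_degree_odd meven m2; first by rewrite oddB // (negPf meven).
  have t2 : tdeg 1 <= 2.
    have [h2 hm] : exists h2, m = (h2 + h2)%N.
      by exists m./2; rewrite addnn -[LHS]odd_double_half (negPf meven).
    by move: t3; rewrite meven /tdeg ha hb hm; lia.
  rewrite ha in b1 tE *; apply: (kummer_degree_even _ b1 b2 tE t2); lia.
have [|p [pE sp rp]] := @generator_product_poly 1; first by rewrite m1.
have t2 : tdeg 1 = 2.
  have := @tdeg_ge2 1; rewrite m1; have -> : (2 * 1 == m)%N = false.
    by apply/eqP => e2; move: modd; rewrite -e2.
  by rewrite modd in t3 => /(_ isT); lia.
rewrite -/(tdeg 1) t2 in sp; have {}sp : size p = 3%N by lia.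
have ip : irreducible_poly p by apply: cubic_irreducible => //; rewrite sp.
have [h' [hE' _ _]] := generator_power_poly m2.
have hp : h %| p ^+ m.
  apply/dvdpP; exists h'; apply: ev_inj; rewrite evM evX -pE -hE -hE' !exprMn.
  have -> : D ^+ m = D * D ^+ (m - 1) by rewrite -exprS; congr (_ ^+ _); lia.
  rewrite expr1; move: (zz 1 ^+ m) (zz (m - 1) ^+ m) (D ^+ (m - 1)) D => A B C E; ring.
have [k hk] := size_dvdp_irreducible_exp ip hp; rewrite sp /= in hk.
have [h2 hm] : exists h2, m = (h2 + h2).+1.
  by exists m./2; rewrite addnn -[LHS]odd_double_half modd.
have hM : m%:Z = 2 * h2%:Z + 1 by rewrite hm; lia.
move: sh b1 tE; rewrite t2 hk hM => sh b1 tE.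
apply: (@kummer_degree_odd k%:Z h2%:Z _ _ _ b1 b2); last by lia.
  by move: m1; rewrite hm; lia.
by rewrite tE hM.
Qed.

(** Each projection of z, times a power of D, is [zz i] times a polynomial in y; and [zz i] is
    itself [zz 1 ^+ i] divided by such a polynomial. For m = 1 only i = 0 occurs, which explains the
    condition on [zz 1]. *)
Lemma subfield_contains (S : F -> Prop) :
  (forall c, S (iota c)) -> S y -> ((1 < m)%N -> S (zz 1)) ->
  (forall a b, S a -> S b -> S (a + b)) -> (forall a, S a -> S (- a)) ->
  (forall a b, S a -> S b -> S (a * b)) -> (forall a, S a -> S a^-1) ->
  forall n z, Lreg n z -> S z.
Proof.
move=> SC Sy Sz SD SN SM SV n z hz.
have SX a k : S a -> S (a ^+ k).
  by move=> Sa; elim: k => [|k IH]; rewrite ?expr0 -?(rmorph1 iota) // exprS; apply: SM.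
have S0 : S 0 by rewrite -(rmorph0 iota).
have Sev p : S (ev p).
  rewrite (ev_sum (leqnn _)); apply: big_ind => // i _; apply: SM => //; exact: SX.
have SDD : S D by apply: SD; [apply: SX|apply: SN].
rewrite -(sum_proj z); apply: big_ind => // -[i im] _ /=.
have [z0 hzi zm _] := Hgen im.
have up x d : T i d x -> exists2 p : {poly K}, True & x = zz i * ev p.
  move=> hx; pose N := `|(d - dd i + 1)%R|%N.
  have [|p _ hp] := gen_poly z0 hzi zm (N := N) (x := x); last by exists p.
  by apply: T_le hx; lia.
have Szi : S (zz i).
  have [u [u0 Su [d hu]]] : exists u, [/\ u != 0, S u & exists d, T i d u].
    have [i0|i0] := posnP i.
      exists 1; split; rewrite ?oner_eq0 -?(rmorph1 iota) //; exists 0; rewrite rmorph1 i0.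
      by apply: L_le L0_one => l; rewrite mul0r.
    have m1 : (1 < m)%N by apply: leq_ltn_trans im.
    have [z10 h1 _ _] := Hgen m1; exists (zz 1 ^+ i); split; rewrite ?expf_neq0 //.
      by apply: SX; apply: Sz.
    by exists (i%:Z * dd 1%N); have := L_exp i h1; rewrite mul1n; apply: L_le => l; lia.
  have [p _ hp] := up u d hu.
  have p0 : ev p != 0 by apply: contra_neq u0 => p0; rewrite hp p0 mulr0.
  have -> : zz i = u / ev p by rewrite hp mulfK.
  by apply: SM => //; apply: SV.
pose N := (\sum_k `|n k|)%N.
have hN k : n k <= N%:Z.
  have : (`|n k| <= N)%N by rewrite /N (bigD1 k) //= leq_addr.
  lia.
have hx : L i (fun=> N%:Z) (proj i z).
  by apply: L_proj => //; apply: Lreg_le hz => k; have := hN k; move: m_gt0; nia.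
have [|p _ hp] := up (proj i z * D ^+ N) ((m%:Z + 2) * N%:Z).
  have := L_mul hx (L0_exp N UD0); rewrite addn0; apply: L_le => l.
  by rewrite deltaE; case: (l == oo); lia.
have -> : proj i z = zz i * ev p / D ^+ N by rewrite -hp mulfK ?expf_neq0.
by apply: (SM); [apply: SM|apply: SV; apply: SX].
Qed.

End Kummer.
End Gens.
End Coordinate.

Lemma kummer_model (s : F -> F) : is_Kaut iota s -> (forall z, e z = iter q.+1 s z) ->
  exists y z, [/\ forall v, is_place iota v -> (forall i, ~ v =1 P i) -> vge v 0 y,
    forall p r : {poly K}, (map_poly iota p).[y] = (map_poly iota r).[y] -> p = r,
    (1 < m)%N -> exists h : {poly K}, [/\ z ^+ m * (y ^+ q - y) = (map_poly iota h).[y],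
       size h = 3%N & forall a, ~~ root h a] &
    forall S : F -> Prop,
      (forall c, S (iota c)) -> S y -> ((1 < m)%N -> S z) ->
      (forall a b, S a -> S b -> S (a + b)) -> (forall a, S a -> S (- a)) ->
      (forall a b, S a -> S b -> S (a * b)) -> (forall a, S a -> S a^-1) ->
      forall n z, Lreg n z -> S z].
Proof.
move=> Hs es; have [y [Ty vy lk lkK UD]] := coordinate.
have [dd [zz Hgen]] := generators_exist.
exists y, (zz 1%N); split.
- exact: Ty.2.2.
- by move=> p r; apply: ev_inj.
- by move=> m1; apply: (kummer_quadratic Ty vy lk lkK UD Hgen Hs es m1).
by move=> S h1 h2 h3 h4 h5 h6 h7; apply: (subfield_contains Ty vy UD Hgen).
Qed.

End Kappa.
End Genus.
End Setup.

(** * Algebraicity over K(y) *)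

Lemma fraction_repr (R : idomainType) (u : {fraction R}) :
  exists p : R * R, p.2 != 0 /\ u * tofrac p.2 = tofrac p.1.
Proof.
elim/quotW: u => r; exists (\n_r, \d_r); split; first exact: denom_ratioP.
rewrite /=; unlock FracField.tofrac.
rewrite -[LHS]FracField.pi_mul; apply/eqP; rewrite FracField.equivf_def.
by rewrite /FracField.mulf /= !numden_Ratio ?oner_neq0 ?mulr1 ?mulf_neq0 ?denom_ratioP // mulrC.
Qed.

Lemma common_denominator (R : idomainType) (p : {poly {fraction R}}) :
  exists d Q, d != 0 /\ tofrac d *: p = map_poly tofrac Q.
Proof.
elim/poly_ind: p => [|p c [d [Q [d0 hQ]]]].
  by exists 1, 0; rewrite oner_neq0 scaler0 rmorph0.
have [[n e] /= [e0 hc]] := fraction_repr c.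
exists (d * e), (e%:P * Q * 'X + (d * n)%:P); rewrite mulf_neq0 //; split=> //.
rewrite rmorphD !rmorphM /= map_polyX !map_polyC /= -hQ -hc -!mul_polyC.
rewrite !polyCM; move: (_%:P) (_%:P) (c%:P) 'X => A B C X.
rewrite mulrDr; congr (_ + _); last by rewrite -mulrA [A * C]mulrC.
by rewrite mulrA [B * A]mulrC -!mulrA.
Qed.

Section FractionLift.
Variables (R : idomainType) (F : fieldType) (f : {rmorphism R -> F}).
Hypothesis f_inj : forall r, r != 0 -> f r != 0.

(** The representative is an arbitrary choice; [fraction_lift_eq] shows that the value does not
    depend on it. *)
Definition fraction_lift (u : {fraction R}) : F :=
  let p := projT1 (cid (fraction_repr u)) in f p.1 / f p.2.

Lemma fraction_lift_eq u n d : d != 0 -> u * tofrac d = tofrac n ->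
  fraction_lift u = f n / f d.
Proof.
rewrite /fraction_lift; case: cid => -[n' d'] /= [d'0 h'] d0 h.
apply/eqP; rewrite eqr_div ?f_inj // -!rmorphM; apply/eqP; congr (f _).
apply/eqP; rewrite -tofrac_eq !tofracM -h -h'; apply/eqP; ring.
Qed.

Lemma fraction_lift_zmod_morphism : zmod_morphism fraction_lift.
Proof.
move=> u v; have [[n d] /= [d0 h]] := fraction_repr u.
have [[n' d'] /= [d'0 h']] := fraction_repr v.
rewrite (fraction_lift_eq d0 h) (fraction_lift_eq d'0 h').
rewrite (@fraction_lift_eq _ (n * d' - n' * d) (d * d')) ?mulf_neq0 //.
  by rewrite rmorphB !rmorphM; field; rewrite !f_inj.
by rewrite tofracB !tofracM -h -h'; ring.
Qed.

Lemma fraction_lift_monoid_morphism : monoid_morphism fraction_lift.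
Proof.
split.
  rewrite (@fraction_lift_eq 1 1 1) ?oner_neq0 ?mul1r //.
  by rewrite rmorph1 divr1.
move=> u v; have [[n d] /= [d0 h]] := fraction_repr u.
have [[n' d'] /= [d'0 h']] := fraction_repr v.
rewrite (fraction_lift_eq d0 h) (fraction_lift_eq d'0 h').
rewrite (@fraction_lift_eq _ (n * n') (d * d')) ?mulf_neq0 //.
  by rewrite !rmorphM; field; rewrite !f_inj.
by rewrite !tofracM -h -h'; ring.
Qed.

Lemma fraction_lift_rmorphism :
  exists j : {rmorphism {fraction R} -> F}, forall r, j (tofrac r) = f r.
Proof.
pose jz := GRing.isZmodMorphism.Build {fraction R} F _ fraction_lift_zmod_morphism.
pose jm := GRing.isMonoidMorphism.Build {fraction R} F _ fraction_lift_monoid_morphism.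
pose j : {rmorphism {fraction R} -> F} := HB.pack fraction_lift jz jm.
exists j => r; rewrite -[j _]/(fraction_lift _).
rewrite (@fraction_lift_eq _ r 1) ?oner_neq0 //; last by rewrite tofrac1 mulr1.
by rewrite rmorph1 divr1.
Qed.

End FractionLift.

Section Algebraicity.
Variables (K : finFieldType) (F : fieldType) (iota : {rmorphism K -> F}).
Local Notation Kx := {fraction {poly K}}.
Local Notation ev z p := ((map_poly iota p).[z]).

Lemma transcendental_lift (z : F) : transcendental iota z ->
  exists j : {rmorphism Kx -> F}, forall p, j (tofrac p) = ev z p.
Proof.
move=> tz; pose f : {rmorphism {poly K} -> F} := horner_eval z \o map_poly iota.
have f_inj r : r != 0 -> f r != 0.
  by move=> r0; apply: contra_neq r0 => /tz.
by have [j hj] := fraction_lift_rmorphism f_inj; exists j.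
Qed.

Lemma root_common_denominator (j : {rmorphism Kx -> F}) z a (p : {poly Kx}) :
  (forall r, j (tofrac r) = ev z r) -> root (map_poly j p) a -> p != 0 ->
  exists d Q, [/\ d != 0, Q != 0, tofrac d *: p = map_poly tofrac Q &
    root (map_poly (fun r => ev z r) Q) a].
Proof.
move=> hj ra p0; have [d [Q [d0 hQ]]] := common_denominator p.
exists d, Q; split=> //.
  by apply: contra_neq p0 => Q0; move: hQ; rewrite Q0 rmorph0 => /eqP;
     rewrite scaler_eq0 tofrac_eq0 (negPf d0) => /eqP.
have -> : map_poly (fun r => ev z r) Q = map_poly j (map_poly tofrac Q).
  by apply/polyP => i; rewrite !coef_map_id0 ?rmorph0 ?horner0 // hj.
by rewrite -hQ map_polyZ rootE hornerZ (rootP ra) mulr0.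
Qed.

(** Multiplication by a acts on the spanning family [b] through a matrix over K(x). The row of the
    b_i, nonzero because 1 is in the span, is an eigenvector for a, so a is a root of the
    characteristic polynomial. *)
Lemma integral_over_Kx (x : F) (j : {rmorphism Kx -> F}) :
  (forall p, j (tofrac p) = ev x p) -> finite_over_Kx iota x ->
  forall a, integralOver j a.
Proof.
move=> hj [n [b hb]] a.
have inK u : in_Kx iota x u -> exists r, u = j r.
  by case=> p [r [r0 ->]]; exists (tofrac p / tofrac r); rewrite fmorph_div !hj.
have row i : exists A : 'I_n -> Kx, a * b i = \sum_k j (A k) * b k.
  have [r [hr e]] := hb (a * b i).
  have [A hA] := choice (fun k => inK _ (hr k)).
  by exists A; rewrite e; apply: eq_bigr => k _; rewrite hA.
have [A hA] := choice row.
pose M := \matrix_(k, i) A i k.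
exists (char_poly M); first exact: char_poly_monic.
rewrite map_char_poly -eigenvalue_root_char; apply/eigenvalueP.
exists (\row_i b i).
  apply/rowP => i; rewrite !mxE hA; apply: eq_bigr => k _.
  by rewrite !mxE mulrC.
apply/eqP => b0; have [r [_ e]] := hb 1; move: e => /eqP; rewrite big1 ?oner_eq0 // => i _.
by have := congr1 (fun v : 'rV_n => v 0 i) b0; rewrite !mxE => ->; rewrite mulr0.
Qed.

(** Exchange: an equation of y over K(x), cleared of denominators, is a nonzero bivariate relation;
    read with the variables swapped it makes x algebraic over K(y). Transitivity does the rest. *)
Lemma integral_over_transcendental (x y : F) (jx jy : {rmorphism Kx -> F}) :
  (forall p, jx (tofrac p) = ev x p) -> (forall p, jy (tofrac p) = ev y p) ->
  finite_over_Kx iota x -> forall a, integralOver jy a.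
Proof.
move=> hx hy fx a.
have ix : integralOver jy x.
  have [p mp rp] := integral_over_Kx hx fx y.
  have [d [Q [d0 Q0 hQ rQ]]] := root_common_denominator hx rp (monic_neq0 mp).
  apply/integral_algebraic; exists (map_poly tofrac (swapXY Q)).
    by rewrite map_poly_eq0_id0 ?tofrac_eq0 ?lead_coef_eq0 swapXY_eq0.
  move: rQ; rewrite !rootE => /eqP rQ; apply/eqP; rewrite -[RHS]rQ.
  have -> : map_poly jy (map_poly tofrac (swapXY Q)) =
      map_poly (fun r => ev y r) (swapXY Q).
    by apply/polyP => i; rewrite !coef_map_id0 ?rmorph0 ?horner0 // hy.
  have E z (S : {poly {poly K}}) : map_poly (fun r => ev z r) S =
      map_poly (horner_eval z) (map_poly (map_poly iota) S).
    by apply/polyP => i; rewrite !coef_map_id0 ?rmorph0 ?horner0 // /horner_eval horner0.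
  rewrite !E -!horner_swapXY -swapXY_map swapXYK.
  by rewrite horner2_swapXY.
have [p mp rp] := integral_over_Kx hx fx a.
apply: (integral_root (p := map_poly jx p)) => //.
  by rewrite map_poly_eq0 monic_neq0.
apply/integral_poly => i; rewrite coef_map.
have [[n d] /= [d0 hnd]] := fraction_repr p`_i.
have ih (r : {poly K}) : integralOver jy (ev x r).
  apply: integral_horner => //; apply/integral_poly => k; rewrite coef_map /=.
  have -> : iota r`_k = jy (tofrac (r`_k)%:P) by rewrite hy map_polyC hornerC.
  exact: integral_id.
have -> : jx p`_i = ev x n / ev x d.
  rewrite -!hx -hnd rmorphM /= mulfK // fmorph_eq0 tofrac_eq0 //.
exact: integral_div.
Qed.

(* a is algebraic over K(y); d clears the denominators of its minimal equation. *)
Lemma denominator_for_places (x y a : F) :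
  transcendental iota x -> finite_over_Kx iota x -> transcendental iota y ->
  exists2 d : {poly K}, d != 0 &
    forall v, is_place iota v -> vge v 0 y -> vge v 0 (ev y d * a).
Proof.
move=> tx fx ty.
have [jx hx] := transcendental_lift tx; have [jy hy] := transcendental_lift ty.
have [p mp rp] := integral_over_transcendental hx hy fx a.
have [d [Q [d0 _ hQ _]]] := root_common_denominator hy rp (monic_neq0 mp).
exists d => // v Pv vy; set c := ev y d.
have vev (r : {poly K}) : vge v 0 (ev y r).
  rewrite horner_coef; apply: (vge_sum Pv) => i _; rewrite coef_map.
  by apply: (vgeZ Pv); have := vgeX Pv i vy; rewrite mul0rn.
have cj i : c * jy p`_i = ev y Q`_i.
  rewrite /c -hy -rmorphM -hy; congr (jy _).
  by have := congr1 (fun q : {poly Kx} => q`_i) hQ; rewrite coefZ coef_map_id0 ?tofrac0.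
have c0 : c != 0 by rewrite /c -hy fmorph_eq0 tofrac_eq0.
apply/negPn/negP => nb; set b := c * a in nb.
have b0 : b != 0 by apply: contraNneq nb => ->; apply: vge0.
have [n hn] : exists n, size p = n.+1.
  by exists (size p).-1; rewrite prednK // size_poly_gt0 monic_neq0.
have vb : v b < 0 by move: nb; rewrite vgeE // -ltNge.
have pn : p`_n = 1 by have /monicP := mp; rewrite lead_coefE hn.
(* The equation of a times c^n: monic in b = c a, with coefficients polynomial in y and so regular
   at v. If v b < 0, the leading term would strictly dominate. *)
have eq0 : b ^+ n + \sum_(i < n) c ^+ (n - i) * jy p`_i * b ^+ i = 0.
  have : c ^+ n * (map_poly jy p).[a] = 0 by rewrite (rootP rp) mulr0.
  rewrite (horner_coef_wide (n := n.+1)) ?size_map_poly ?hn // big_ord_recr /=.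
  rewrite coef_map /= pn rmorph1 mul1r mulrDr -exprMn addrC => {2}<-; congr (_ + _).
  rewrite mulr_sumr; apply: eq_bigr => i _; rewrite coef_map /= /b exprMn.
  have -> : c ^+ n = c ^+ (n - i) * c ^+ i by rewrite -exprD subnK // ltnW.
  by ring.
have [] := @place_dom _ _ _ v Pv (b ^+ n) (\sum_(i < n) c ^+ (n - i) * jy p`_i * b ^+ i).
- by rewrite expf_neq0.
- apply: (vge_sum Pv) => i _; have hi := ltn_ord i.
  have -> : c ^+ (n - i) * jy p`_i = c ^+ (n - i.+1) * (c * jy p`_i).
    by rewrite mulrA -exprSr subnSK.
  have h1 : vge v (v b *+ i) (b ^+ i) by apply: (vgeX Pv); apply: vge_v.
  have h2 : vge v 0 (c ^+ (n - i.+1) * (c * jy p`_i)).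
    rewrite cj -[0]addr0; apply: (vgeM Pv) => //.
    by have := vgeX Pv (n - i.+1) (vev d); rewrite mul0rn.
  apply: vgeW (vgeM Pv h2 h1); rewrite (placeX Pv) add0r !mulrn_int.
  have {}hi : i%:Z + 1 <= n%:Z by rewrite -(PoszD i 1) lez_nat addn1.
  by move: (v b) (i%:Z) (n%:Z) vb hi => V i' n' vb hi; clear -vb hi; nia.
by rewrite eq0 eqxx.
Qed.

End Algebraicity.

(** * The Carlitz module *)

Lemma exprD_card (K : finFieldType) (R : comNzRingType) (f : {rmorphism K -> R}) (a b : R) :
  (a + b) ^+ #|K| = a ^+ #|K| + b ^+ #|K|.
Proof.
have [p pr_p chp] := finPcharP K.
have cK : #|K| = (p ^ logn p #|K|)%N := card_pprimeChar chp.
apply: exprDn_pchar; rewrite cK pnatX pnatE // (rmorph_pchar f) //.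
Qed.

Section Carlitz.
Variables (K : finFieldType) (F : fieldType) (iota : {rmorphism K -> F}).
Local Notation q := #|K|.
Local Notation ev z p := ((map_poly iota p).[z]).
Variables (y l : F) (M : {poly K}).
Hypotheses (Hc : full_constant_field iota) (yc : forall c, y <> iota c)
  (sM : size M = 3%N) (mM : M \is monic) (M0 : forall a, ~~ root M a)
  (hl : l ^+ q.-1 * (y ^+ q - y) = - ev y M).

Lemma transcendental_nonconst z : (forall c, z <> iota c) -> transcendental iota z.
Proof.
move=> zc p hp; apply/eqP/negPn/negP => p0; have [|c hc] := Hc (z := z).
  by exists p.
exact: zc hc.
Qed.

Let ty : transcendental iota y := transcendental_nonconst yc.
Let qm : q = q.-1.+1. Proof. by rewrite prednK // ltnW // card_gt1. Qed.

Let a1 := iota M`_1.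
Let a0 := iota M`_0.

Let evM : ev y M = y ^+ 2 + a1 * y + a0.
Proof.
have M2 : M`_2 = 1 by have /monicP := mM; rewrite lead_coefE sM.
rewrite horner_coef size_map_poly sM !big_ord_recr big_ord0 /= !coef_map /= M2.
by rewrite rmorph1 expr0 expr1 /a1 /a0; ring.
Qed.

Let D0 : y ^+ q - y != 0.
Proof.
have s1 : (1 < q)%N := card_gt1 K.
apply/eqP => h; have : 'X^q - 'X = 0 :> {poly K}.
  by apply: ty; rewrite rmorphB /= map_polyXn map_polyX hornerD hornerN hornerXn hornerX.
move/(congr1 (fun p : {poly K} => p`_q)); rewrite coefB coefXn coefX eqxx coef0 gtn_eqF //.
by rewrite subr0 => /eqP; rewrite oner_eq0.
Qed.

Let l0 : l != 0.
Proof.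
apply/eqP => l0; have m0 : q.-1 != 0%N by have := card_gt1 K; case: q => [|[]].
move: hl; rewrite l0 expr0n (negPf m0) mul0r => /esym/eqP; rewrite oppr_eq0 => /eqP /ty M00.
by move: sM; rewrite M00 size_poly0.
Qed.

(* Solving the Carlitz equation of M for x in terms of y = phi(l) / l. *)
Let x := (y ^+ q.+1 + a1 * y + a0) / (y ^+ q - y).

Let xE : y ^+ q.+1 + a1 * y + a0 = x * (y ^+ q - y).
Proof. by rewrite /x divfK. Qed.

(** Multiplied by l this is phi(l) = l y. *)
Let lE : l ^+ q.-1 + x = y.
Proof.
apply: (mulIf D0); rewrite mulrDl hl -xE evM [y ^+ q.+1]exprS; ring.
Qed.

Let tx : transcendental iota x.
Proof.
apply: transcendental_nonconst => c hc.
have s1 : (1 < q)%N := card_gt1 K.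
have : 'X^(q.+1) + (M`_1 *: 'X + (M`_0)%:P - c *: ('X^q - 'X)) = 0 :> {poly K}.
  apply: ty; rewrite !rmorphD rmorphN /= !map_polyZ rmorphB /= !map_polyXn map_polyX map_polyC /=.
  rewrite !(hornerD, hornerN, hornerZ, hornerXn, hornerX, hornerC).
  by rewrite -/a1 -/a0 -hc -xE; ring.
move/(congr1 (fun p : {poly K} => p`_q.+1)).
rewrite !(coefB, coefD, coefZ, coefXn, coefX, coefC, coef0) eqxx.
have -> : (q.+1 == 1)%N = false by lia.
have -> : (q.+1 == q)%N = false by lia.
by rewrite /= !(mulr0, subr0, addr0) => /eqP; rewrite oner_eq0.
Qed.

Definition carlitz_action (z : F) := z ^+ q + x * z.

Lemma carlitz_action_lin a b u v : carlitz_action (iota a * u + iota b * v) =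
  iota a * carlitz_action u + iota b * carlitz_action v.
Proof.
rewrite /carlitz_action (exprD_card iota) !exprMn -!rmorphXn !expf_card; ring.
Qed.

Lemma carlitz_action_l : carlitz_action l = l * y.
Proof. by rewrite /carlitz_action -lE {1}qm exprS; ring. Qed.

(** Since l y = phi(l), this says that M(phi) kills l: phi acts on the K-span of l and l y as a
    companion matrix of M. *)
Lemma carlitz_action_ly : carlitz_action (l * y) = - a1 * (l * y) - a0 * l.
Proof.
have e1 : l ^+ q = l * (y - x) by rewrite -lE addrK {1}qm exprS.
rewrite /carlitz_action exprMn e1.
have -> : l * (y - x) * y ^+ q + x * (l * y) = l * (y * y ^+ q - x * (y ^+ q - y)) by ring.
by rewrite -xE exprS; ring.
Qed.

Let rs := [seq iota c.1 * l + iota c.2 * (l * y) | c : K * K].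

Section Morphism.
Variable j : {rmorphism {fraction {poly K}} -> F}.
Hypothesis hj : forall p, j (kx p) = ev x p.

Let jC c : j (kx c%:P) = iota c. Proof. by rewrite hj map_polyC hornerC. Qed.

Let mapD p r : map_poly j (p + r) = map_poly j p + map_poly j r.
Proof. exact: rmorphD. Qed.

Let mapCM c p : map_poly j ((kx c%:P)%:P * p) = (iota c)%:P * map_poly j p.
Proof. by rewrite rmorphM /= map_polyC /= jC. Qed.

Lemma horner_carlitz z :
  (map_poly j (carlitz_poly M)).[z] =
  a0 * z + a1 * carlitz_action z + carlitz_action (carlitz_action z).
Proof.
have M2 : M`_2 = 1 by have /monicP := mM; rewrite lead_coefE sM.
have step (p : {poly {fraction {poly K}}}) : (map_poly j (carlitz_phi K \Po p)).[z] =
    carlitz_action (map_poly j p).[z].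
  rewrite map_comp_poly horner_comp /carlitz_phi rmorphD rmorphM /= map_polyXn map_polyX map_polyC /=.
  by rewrite hj map_polyX hornerX !hornerE.
rewrite /carlitz_poly sM !big_ord_recr big_ord0 /= add0r M2.
rewrite !(mapD, mapCM) rmorph1 mul1r !(hornerD, hornerM, hornerC) !step.
by rewrite map_polyX hornerX.
Qed.

Lemma carlitz_roots : map_poly j (carlitz_poly M) = \prod_(r <- rs) ('X - r%:P).
Proof.
have M2 : M`_2 = 1 by have /monicP := mM; rewrite lead_coefE sM.
have s1 : (1 < q)%N := card_gt1 K.
(* As phi(phi(X)) = X^(q^2) + (x^q + x) X^q + x^2 X, this is everything below the leading term. The
   polynomial is thus monic of degree q^2, the number of K-combinations of l and l y. *)
pose R := a0 *: 'X + a1 *: ('X^q + x *: 'X) + (x ^+ q + x) *: 'X^q + x ^+ 2 *: 'X : {poly F}.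
have jphi : map_poly j (carlitz_phi K) = 'X^q + x *: 'X.
  rewrite /carlitz_phi rmorphD rmorphM /= map_polyXn map_polyX map_polyC /=.
  by rewrite hj map_polyX hornerX mul_polyC.
have pE : map_poly j (carlitz_poly M) = 'X^(q * q) + R.
  rewrite /carlitz_poly sM !big_ord_recr big_ord0 /= add0r M2.
  rewrite !(mapD, mapCM) rmorph1 mul1r.
  rewrite !map_comp_poly !jphi map_polyX !comp_polyD !comp_polyZ !comp_polyX !comp_Xn_poly.
  rewrite (exprD_card (polyC \o iota)) exprM exprZn /R -!mul_polyC polyCD.
  rewrite [(x ^+ 2)%:P]polyC_exp -/a0 -/a1.
  move: 'X (a1%:P) (a0%:P) (x%:P) ((x ^+ q)%:P) => X A1 A0 Y C.
  ring.
have sR : (size R <= q.+1)%N.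
  have h1 : (size ('X : {poly F}) <= q.+1)%N by rewrite size_polyX; lia.
  have h2 : (size ('X^q : {poly F}) <= q.+1)%N by rewrite size_polyXn.
  have hZ c (p : {poly F}) : (size p <= q.+1)%N -> (size (c *: p)%R <= q.+1)%N.
    by move=> hp; apply: leq_trans (size_scale_leq _ _) hp.
  have hD (p r : {poly F}) : (size p <= q.+1)%N -> (size r <= q.+1)%N -> (size (p + r)%R <= q.+1)%N.
    by move=> hp hr; apply: leq_trans (size_polyD _ _) _; rewrite geq_max hp.
  exact: (hD _ _ (hD _ _ (hD _ _ (hZ _ _ h1) (hZ _ _ (hD _ _ h2 (hZ _ _ h1)))) (hZ _ _ h2)) (hZ _ _ h1)).
have sX : (size R < size ('X^(q * q) : {poly F}))%N.
  by rewrite size_polyXn ltnS (leq_trans sR) //; nia.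
have lc : lead_coef (map_poly j (carlitz_poly M)) = 1.
  by rewrite pE lead_coefDl // lead_coefXn.
rewrite -[RHS]scale1r -lc; apply: all_roots_prod_XsubC.
- by rewrite pE size_polyDl // size_polyXn size_map -cardE card_prod.
- apply/allP => _ /mapP[c _ ->]; rewrite rootE horner_carlitz.
  have phir u v : carlitz_action (iota u * l + iota v * (l * y)) =
      iota (- v * M`_0) * l + iota (u - v * M`_1) * (l * y).
    rewrite carlitz_action_lin carlitz_action_l carlitz_action_ly.
    by rewrite rmorphB !rmorphM rmorphN -/a0 -/a1; ring.
  rewrite !phir !(rmorphB, rmorphM, rmorphN) /= -/a0 -/a1; apply/eqP; ring.
rewrite uniq_rootsE map_inj_uniq ?enum_uniq // => -[a b] [a' b'] /= e.
(* After division by l, equal roots mean a + b y = a' + b' y, and y is transcendental. *)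
have e2 : a%:P + b *: 'X = a'%:P + b' *: 'X :> {poly K}.
  apply/eqP; rewrite -subr_eq0; apply/eqP/ty; apply: (mulfI l0).
  rewrite mulr0 !(rmorphB, rmorphD) /= !map_polyZ !map_polyC map_polyX !hornerE /=.
  by move/eqP: e; rewrite -subr_eq0 => /eqP {1}<-; ring.
have := congr1 (fun p : {poly K} => p`_0) e2; have := congr1 (fun p : {poly K} => p`_1) e2.
by rewrite /= !(coefD, coefC, coefZ, coefX) /= !(mulr0, mulr1, addr0, add0r) => -> ->.
Qed.

End Morphism.

(** E is F itself, with the variable of K(x) sent to the element [x]; y is recovered as l y divided
    by l. *)
Lemma cyclotomic_of_kummer :
  (forall S : F -> Prop, (forall c, S (iota c)) -> S y -> S l ->
      (forall a b, S a -> S b -> S (a + b)) -> (forall a, S a -> S (- a)) ->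
      (forall a b, S a -> S b -> S (a * b)) -> (forall a, S a -> S a^-1) ->
      forall z, S z) ->
  exists (E : fieldType) (j : {rmorphism {fraction {poly K}} -> E}) (s : F -> E),
      [/\ is_cyclotomic_field M j, ring_iso s &
          forall c : K, s (iota c) = j (kx (c%:P))].
Proof.
move=> gen; have [j hj] := transcendental_lift tx.
have jC c : j (kx c%:P) = iota c by rewrite hj map_polyC hornerC.
exists F, j, id; split; [|by split=> //; split=> //; split=> //; exists id|by []].
exists rs; split; first exact: carlitz_roots.
move=> S Sj Srs SD SN SM SV.
have inrs c : iota c.1 * l + iota c.2 * (l * y) \in rs.
  by apply/mapP; exists c => //; rewrite mem_enum.
have Sl : S l.
  by have := Srs _ (inrs (1, 0)); rewrite /= rmorph1 rmorph0 mul1r mul0r addr0.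
apply: gen => //; first by move=> c; rewrite -jC.
have Sly : S (l * y).
  by have := Srs _ (inrs (0, 1)); rewrite /= rmorph1 rmorph0 mul1r mul0r add0r.
have -> : y = l * y * l^-1 by rewrite mulrAC divff ?mul1r.
by apply: SM => //; apply: SV.
Qed.

End Carlitz.

Theorem theorem3p6 (K : finFieldType) (F : fieldType) (iota : {rmorphism K -> F})
  (g : int) :
  is_function_field iota ->
  has_genus iota g ->
  has_Fq2_units_subgroup iota ->
  g = ((((#|K| + 1) * (#|K| - 2)) %/ 2)%N)%:Z ->
  exactly_rational_places iota (#|K| + 1) ->
  exists M : {poly K},
    [/\ M \is monic, irreducible_poly M & size M = 3%N] /\
    exists (E : fieldType) (j : {rmorphism {fraction {poly K}} -> E}) (s : F -> E),
      [/\ is_cyclotomic_field M j, ring_iso s &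
          forall c : K, s (iota c) = j (kx (c%:P))].
Proof.
move=> [[x [tx fx]] Hc] Hg Hu gE Hrat.
have q1 := card_gt1 K.
have [s Hs order_s] := generator_of_Fq2_units Hu.
have [P [w [PR PI PA [Ptr hw] Pe]]] := rational_places_orbit Hs order_s Hrat.
pose e := iter #|K|.+1 s.
have He : is_Kaut iota e by apply: Kaut_iter.
have em : iter #|K|.-1 e =1 id.
  have h : iter (#|K|.-1 * #|K|.+1) s =1 id by apply/order_s; rewrite order_factor.
  by move=> z; rewrite /e -iterM h.
have Pfix i := (Pe i).1.
have Pchar i := (Pe i).2.
have Hgv : 2 * g = (#|K|.-1%:Z + 2) * (#|K|.-1%:Z - 1).
  have [n hn] : exists n, #|K| = n.+2 by exists (#|K| - 2)%N; lia.
  have ev : (2 %| n.+3 * n)%N by rewrite dvdn2 oddM /= negbK; case: (odd n).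
  have := divnK ev; rewrite gE hn /=.
  have -> : (n.+2 + 1 = n.+3)%N by lia.
  have -> : (n.+2 - 2 = n)%N by lia.
  by move=> h; nia.
have [kap [Cs [k1 k2 k3 k4]]] := kappa_exists He em PR PI Pfix hw Pchar Hg Hgv Hc.
have Ptrans i j : exists f, [/\ is_Kaut iota f, forall z, f (e z) = e (f z) & P i \o f =1 P j].
  have [k hk] := Ptr i j; exists (iter k s); split=> //; first exact: Kaut_iter.
  by move=> z; rewrite /e -!iterD addnC.
have [y [z [yreg yinj hh gen]]] := kummer_model He em PR PI Pfix hw Pchar Hg Hgv Hc
  k1 k2 k3 k4 PA Ptrans Hs (fun z => erefl).
have ync c : y <> iota c.
  move=> yc; have := yinj 'X c%:P; rewrite map_polyX map_polyC hornerX hornerC => /(_ yc).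
  by move/(congr1 (fun p : {poly K} => size p)); rewrite size_polyX size_polyC; case: (c == 0).
have ty : transcendental iota y := transcendental_nonconst Hc ync.
have reg a : exists2 d : {poly K}, d != 0 & exists n, Lreg iota P n ((map_poly iota d).[y] * a).
  have [d d0 hd] := denominator_for_places a tx fx ty; exists d => //.
  set b := _ * a; exists (fun k => - P k b); split=> [k|v Pv hv].
    by rewrite opprK; apply: vge_v.
  by apply: hd => //; apply: yreg.
have all_in (S : F -> Prop) : (forall c, S (iota c)) -> S y -> ((1 < #|K|.-1)%N -> S z) ->
      (forall a b, S a -> S b -> S (a + b)) -> (forall a, S a -> S (- a)) ->
      (forall a b, S a -> S b -> S (a * b)) -> (forall a, S a -> S a^-1) ->
      forall a, S a.
  move=> SC Sy Sz SD SN SM SV a; have [d d0 [n hn]] := reg a.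
  have Sn := gen S SC Sy Sz SD SN SM SV.
  have dn0 : (map_poly iota d).[y] != 0 by apply: contra_neq d0 => /ty.
  have Sd : S (map_poly iota d).[y].
    have SX k : S (y ^+ k).
      by elim: k => [|k IH]; [rewrite expr0 -(rmorph1 iota)|rewrite exprS; apply: SM].
    rewrite horner_coef; apply: big_ind => // [|i _]; first by rewrite -(rmorph0 iota).
    by rewrite coef_map; apply: SM; [apply: SC|apply: SX].
  have -> : a = (map_poly iota d).[y]^-1 * ((map_poly iota d).[y] * a) by rewrite mulKf.
  by apply: SM; [apply: SV|apply: Sn hn].
have [m1|m1] := ltnP 1 #|K|.-1.
  have [h [hE sh rh]] := hh m1.
  have h0 : lead_coef h != 0 by rewrite lead_coef_eq0 -size_poly_eq0 sh.
  (* As b^q = b, replacing y by y / b divides y^q - y by b and turns h into h(b X) / b. Its negative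
     M has leading coefficient -b times that of h, and this b makes it 1. *)
  pose b := - (lead_coef h)^-1; have b0 : b != 0 by rewrite oppr_eq0 invr_eq0.
  have sb : size (b *: 'X : {poly K}) = 2%N by rewrite size_scale // size_polyX.
  pose M := - b^-1 *: (h \Po (b *: 'X)).
  have sM : size M = 3%N by rewrite size_scale ?size_comp_poly2 // oppr_eq0 invr_eq0.
  have mM : M \is monic.
    rewrite monicE lead_coefZ lead_coef_comp ?sb // sh lead_coefZ lead_coefX mulr1 /=.
    by rewrite /b invrN invrK opprK sqrrN exprVn mulrA -expr2 divff // expf_neq0.
  have rM a : ~~ root M a.
    rewrite rootE hornerZ mulf_eq0 oppr_eq0 invr_eq0 (negPf b0) horner_comp.
    exact: rh.
  exists M; split; first by split=> //; apply: cubic_irreducible => //; rewrite sM.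
  have ib0 : iota b != 0 by rewrite fmorph_eq0.
  have yE : y = iota b * (y / iota b) by rewrite mulrC divfK.
  apply: (@cyclotomic_of_kummer _ _ _ (y / iota b) z) => //.
  - by move=> c yc; apply: (ync (b * c)); rewrite rmorphM -yc.
  - rewrite /M map_polyZ map_comp_poly map_polyZ map_polyX hornerZ horner_comp hornerZ hornerX.
    rewrite -yE -hE; have -> : iota (- b^-1) = - (iota b)^-1 by rewrite rmorphN fmorphV.
    rewrite expr_div_n -rmorphXn expf_card.
    by move: (z ^+ _) (y ^+ _) (iota b) ib0 => A B C C0; field.
  move=> S SC Sy Sz SD SN SM SV; apply: all_in => //.
  by rewrite yE; apply: SM.
(* For q = 2 the field F is K(y), and l may be chosen freely. *)
have q2 : #|K| = 2%N by lia.
pose M : {poly K} := 'X^2 + ('X + 1).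
have sM : size M = 3%N.
  by rewrite size_polyDl ?size_polyXn // size_polyDl ?size_polyX ?size_poly1.
have mM : M \is monic.
  by rewrite monicE lead_coefDl ?lead_coefXn // size_polyXn size_polyDl ?size_polyX ?size_poly1.
have rM a : ~~ root M a.
  rewrite rootE /M !hornerE; have := expf_card a; rewrite q2 => ->.
  have := natr_card_finField K; rewrite q2 => t2.
  by rewrite /= -mulr2n -mulr_natr t2 mulr0 add0r oner_eq0.
exists M; split; first by split=> //; apply: cubic_irreducible => //; rewrite sM.
have D0 : y ^+ #|K| - y != 0.
  apply/eqP => h; have := yinj 'X^2 'X.
  rewrite map_polyXn map_polyX hornerXn hornerX -q2 => /(_ (subr0_eq h)).
  move/(congr1 (fun p : {poly K} => size p)).
  by rewrite size_polyXn size_polyX q2.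
(* With q - 1 = 1 the Kummer equation is linear in l, and this is its solution. *)
apply: (@cyclotomic_of_kummer _ _ _ y (- (map_poly iota M).[y] / (y ^+ #|K| - y))) => //.
  by rewrite [X in _ ^+ X](_ : _ = 1%N) ?expr1 ?divfK // q2.
move=> S SC Sy _ SD SN SM SV; apply: all_in => //; lia.
Qed.
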